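(* Let $V\in C^2(\mathbb{R},\mathbb{R})$ satisfy $V(x)\ge0$ for all $x$, $V(-1)=V(1)=0$, $V(x)>0$ for $x\in(-1,1)$, and $V''(-1),V''(1)>0$. Let $a:\mathbb{R}\to\mathbb{R}$ be continuous and asymptotically periodic: there is a continuous periodic function $a_P:\mathbb{R}\to\mathbb{R}$ with $|a(t)-a_P(t)|\to0$ as $|t|\to+\infty$ and $0<\inf_{s\in\mathbb{R}}a(s)\le a(t)<a_P(t)$ for all $t\in\mathbb{R}$. Then for each $\epsilon>0$ the problem $\ddot x(t)=a(\epsilon t)V'(x(t))$, $t\in\mathbb{R}$, $x(t)\to-1$ as $t\to-\infty$, $x(t)\to1$ as $t\to+\infty$, has a solution $x\in H^1_{loc}(\mathbb{R})\cap C^2(\mathbb{R})$. Moreover, $x(t)\in(-1,1)$ for all $t\in\mathbb{R}$. *)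

(* Defs.v *)
From Stdlib Require Import Reals.
From Coquelicot Require Import Coquelicot.
Open Scope R_scope.

Definition C2_with (f df ddf : R -> R) : Prop :=
  (forall x, is_derive f x (df x)) /\
  (forall x, is_derive df x (ddf x)) /\
  (forall x, continuous ddf x).

Definition periodic (p : R -> R) : Prop :=
  exists T : R, 0 < T /\ forall t, p (t + T) = p t.

(* Main.v *)
Require Import Defs.
From Stdlib Require Import Reals Lra Lia ClassicalEpsilon Cantor.
From Coquelicot Require Import Coquelicot.
Open Scope R_scope.

(** The action [int x'^2/2 + a(eps t) V(x)] is minimized over C^1 paths that equal -1 near
    -oo and 1 near +oo. Its infimum [m] is strictly below the infimum [mP] for the periodic
    coefficient: a near-minimizer of the periodic problem can be translated by a period so
    that it crosses 0 in a fixed window, where replacing [aP] by [a] saves a fixed amount.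
    A minimizing sequence for [a] is bounded and equi-Hoelder, so a subsequence converges
    locally uniformly; the first variation along the sequence shows that the limit solves
    the equation, and finiteness of the action forces it to tend to 1 or -1 at each end. If
    the limit tended to -1 at +oo, the transition would escape to the region where [a] and
    [aP] nearly agree, and cutting the sequence off there would give [mP <= m]. Replacing
    [V] outside [-1, 1] by squared distances makes [V'] globally Lipschitz and, by the
    maximum principle and uniqueness for the Cauchy problem, does not affect the solution. *)

(** * Integrals of continuous functions *)

(** The obstacle is loss of compactness by translation: a minimizing sequence may carry its
    transition off to infinity and leave a limit sitting in one well. Only two wrong behaviours have
    to be excluded, a limit -1 at the right end and a limit 1 at the left end; they also cover the
    constant limits -1 and 1. The second reduces to the first by the symmetry taking [x(t)] to
    [- x(- t)], which exchanges both the ends of time and the wells.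

    The limit is never shown to be a minimizer, and its kinetic energy is never estimated.
    Competitors are C^1 and exactly constant far out, so every integral is that of a continuous
    function over a compact interval, and neither Sobolev spaces nor weak convergence enter. In
    exchange, the derivatives along the minimizing sequence have no limit at hand. The equation is
    therefore first obtained in twice integrated form, where only the paths themselves occur, and
    the regularity of the limit is read off from that formula. *)

Definition cont (f : R -> R) : Prop := forall t, continuous f t.

Lemma cont_const (c : R) : cont (fun _ => c).
Proof. intros t. apply continuous_const. Qed.

Lemma cont_id : cont (fun t => t).
Proof. intros t. apply continuous_id. Qed.

Lemma cont_plus (f g : R -> R) : cont f -> cont g -> cont (fun t => f t + g t).
Proof. intros Hf Hg t. apply (continuous_plus f g); auto. Qed.

Lemma cont_opp (f : R -> R) : cont f -> cont (fun t => - f t).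
Proof. intros Hf t. apply (continuous_opp f); auto. Qed.

Lemma cont_minus (f g : R -> R) : cont f -> cont g -> cont (fun t => f t - g t).
Proof. intros Hf Hg t. apply (continuous_minus f g); auto. Qed.

Lemma cont_mult (f g : R -> R) : cont f -> cont g -> cont (fun t => f t * g t).
Proof. intros Hf Hg t. apply (continuous_mult f g); auto. Qed.

Lemma cont_comp (f g : R -> R) : cont f -> cont g -> cont (fun t => f (g t)).
Proof. intros Hf Hg t. apply (continuous_comp g f); auto. Qed.

Lemma cont_abs (f : R -> R) : cont f -> cont (fun t => Rabs (f t)).
Proof. intros Hf t. apply (continuous_comp f Rabs); auto. apply continuous_Rabs. Qed.

Lemma cont_pow (f : R -> R) (n : nat) : cont f -> cont (fun t => f t ^ n).
Proof.
  intros Hf. induction n as [|n IH]; simpl.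
  - apply cont_const.
  - apply cont_mult; assumption.
Qed.

Lemma cont_derive (f df : R -> R) : (forall t, is_derive f t (df t)) -> cont f.
Proof. intros H t. apply (ex_derive_continuous f). exists (df t). apply H. Qed.

Lemma cont_pt (f : R -> R) (t : R) : cont f -> continuity_pt f t.
Proof. intros Hf. apply continuity_pt_filterlim, Hf. Qed.

Lemma cont_eps (f : R -> R) (t e : R) : cont f -> 0 < e ->
  exists d, 0 < d /\ forall s, Rabs (s - t) < d -> Rabs (f s - f t) < e.
Proof.
  intros Hf He. specialize (Hf t).
  apply filterlim_locally with (eps := mkposreal e He) in Hf.
  destruct Hf as [d Hd]. exists d. split; [apply cond_pos|].
  intros s Hs. apply (Hd s). exact Hs.
Qed.

Lemma cont_lipschitz (f : R -> R) (L : R) :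
  (forall s t, Rabs (f s - f t) <= L * Rabs (s - t)) -> cont f.
Proof.
  intros H t. apply filterlim_locally. intros [e He].
  assert (HL : 0 <= L).
  { specialize (H 1 0). rewrite Rminus_0_r, Rabs_R1 in H.
    pose proof (Rabs_pos (f 1 - f 0)). lra. }
  assert (Hd : 0 < e / (L + 1)) by (apply Rdiv_lt_0_compat; lra).
  exists (mkposreal _ Hd). intros s Hs.
  change (Rabs (s - t) < e / (L + 1)) in Hs. change (Rabs (f s - f t) < e).
  eapply Rle_lt_trans; [apply H|].
  apply Rle_lt_trans with ((L + 1) * Rabs (s - t)).
  { pose proof (Rabs_pos (s - t)). nra. }
  replace e with ((L + 1) * (e / (L + 1))) at 1 by (field; lra).
  apply Rmult_lt_compat_l; lra.
Qed.

(** Structural search on the body of the function. Quotients are split only when the denominator is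
    constant, and composition is the last resort. *)
Ltac ct := repeat first [ assumption | lazymatch goal with
  | |- cont (fun t => t) => apply cont_id
  | |- cont (fun t => @?f t + @?g t) => apply (cont_plus f g)
  | |- cont (fun t => @?f t - @?g t) => apply (cont_minus f g)
  | |- cont (fun t => @?f t * @?g t) => apply (cont_mult f g)
  | |- cont (fun t => @?f t / ?c) => apply (cont_mult f (fun _ => / c))
  | |- cont (fun t => - @?f t) => apply (cont_opp f)
  | |- cont (fun t => @?f t ^ ?n) => apply (cont_pow f n)
  | |- cont (fun t => Rabs (@?f t)) => apply (cont_abs f)
  | |- cont (fun _ => ?c) => apply (cont_const c)
  | |- cont (fun t => ?f (@?g t)) => apply (cont_comp f g)
  end ].

Lemma int_ex (f : R -> R) (u v : R) : cont f -> ex_RInt f u v.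
Proof. intros Hf. apply (ex_RInt_continuous f). intros; apply Hf. Qed.

(* Fixes the codomain of [RInt] to [R], so that [ring], [lra] and [field] recognize it. *)
Definition int (f : R -> R) (u v : R) : R := RInt f u v.

Lemma int_le (f g : R -> R) (u v : R) : u <= v -> cont f -> cont g ->
  (forall t, u < t < v -> f t <= g t) -> int f u v <= int g u v.
Proof. intros. unfold int. apply RInt_le; auto using int_ex. Qed.

Lemma int_plus (f g : R -> R) (u v : R) : cont f -> cont g ->
  int (fun t => f t + g t) u v = int f u v + int g u v.
Proof. intros. apply (RInt_plus f g u v); auto using int_ex. Qed.

Lemma int_minus (f g : R -> R) (u v : R) : cont f -> cont g ->
  int (fun t => f t - g t) u v = int f u v - int g u v.
Proof. intros. apply (RInt_minus f g u v); auto using int_ex. Qed.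

Lemma int_scal (f : R -> R) (k u v : R) : cont f ->
  int (fun t => k * f t) u v = k * int f u v.
Proof. intros. apply (RInt_scal f u v k); auto using int_ex. Qed.

Lemma int_const (c u v : R) : int (fun _ => c) u v = c * (v - u).
Proof. unfold int. rewrite (RInt_const u v c). apply Rmult_comm. Qed.

Lemma int_chasles (f : R -> R) (u v r : R) : cont f ->
  int f u v + int f v r = int f u r.
Proof. intros. apply (RInt_Chasles f u v r); auto using int_ex. Qed.

Lemma int_point (f : R -> R) (u : R) : int f u u = 0.
Proof. apply (RInt_point u f). Qed.

Lemma int_ext (f g : R -> R) (u v : R) : u <= v ->
  (forall t, u < t < v -> f t = g t) -> int f u v = int g u v.
Proof.
  intros Huv H. unfold int. apply RInt_ext. rewrite Rmin_left, Rmax_right by lra. exact H.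
Qed.

Lemma int_derive (f df : R -> R) (u v : R) :
  (forall t, is_derive f t (df t)) -> cont df -> int df u v = f v - f u.
Proof.
  intros Hf Hdf. apply is_RInt_unique.
  apply (is_RInt_derive f df); intros; auto.
Qed.

Lemma derive_int (f : R -> R) (u t : R) : cont f ->
  is_derive (fun s => int f u s) t (f t).
Proof.
  intros Hf. apply (is_derive_RInt f (fun s => int f u s) u t); [|apply Hf].
  apply filter_forall. intros s. apply (RInt_correct f u s). now apply int_ex.
Qed.

Lemma int_ge0 (f : R -> R) (u v : R) : u <= v -> cont f ->
  (forall t, u < t < v -> 0 <= f t) -> 0 <= int f u v.
Proof.
  intros Huv Hf H. replace 0 with (int (fun _ => 0) u v).
  - apply int_le; auto using cont_const.
  - rewrite int_const. ring.
Qed.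

Lemma int_le_const (f : R -> R) (u v c : R) : u <= v -> cont f ->
  (forall t, u < t < v -> f t <= c) -> int f u v <= c * (v - u).
Proof. intros. rewrite <- int_const. apply int_le; auto using cont_const. Qed.

Lemma int_ge_const (f : R -> R) (u v c : R) : u <= v -> cont f ->
  (forall t, u < t < v -> c <= f t) -> c * (v - u) <= int f u v.
Proof. intros. rewrite <- int_const. apply int_le; auto using cont_const. Qed.

Lemma int_subinterval (f : R -> R) (u u' v' v : R) : cont f ->
  u <= u' -> u' <= v' -> v' <= v -> (forall t, 0 <= f t) ->
  int f u' v' <= int f u v.
Proof.
  intros Hf H1 H2 H3 H.
  rewrite <- (int_chasles f u u' v), <- (int_chasles f u' v' v) by assumption.
  assert (0 <= int f u u') by (apply int_ge0; auto).
  assert (0 <= int f v' v) by (apply int_ge0; auto). lra.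
Qed.

Lemma int_abs_le (f : R -> R) (u v c : R) : cont f ->
  (forall t, Rmin u v < t < Rmax u v -> Rabs (f t) <= c) ->
  Rabs (int f u v) <= c * Rabs (v - u).
Proof.
  intros Hf H.
  assert (K : forall p q, p <= q -> (forall t, p < t < q -> Rabs (f t) <= c) ->
    Rabs (int f p q) <= c * (q - p)).
  { intros p q Hpq Hb. unfold int at 1. eapply Rle_trans; [apply abs_RInt_le; auto using int_ex|].
    fold (int (fun t => Rabs (f t)) p q). apply int_le_const; auto using cont_abs. }
  destruct (Rle_dec u v) as [Huv|Huv].
  - rewrite Rmin_left, Rmax_right in H by lra.
    rewrite (Rabs_pos_eq (v - u)) by lra. now apply K.
  - rewrite Rmin_right, Rmax_left in H by lra.
    rewrite (Rabs_left (v - u)) by lra.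
    replace (int f u v) with (- int f v u).
    + rewrite Rabs_Ropp. replace (- (v - u)) with (u - v) by ring. apply K; auto; lra.
    + pose proof (int_chasles f u v u Hf) as E. rewrite int_point in E. lra.
Qed.

(** Nonnegativity of the variance: expand the integral of [(f t - c) ^ 2], where [c] is the mean of
    [f] on the interval. *)
Lemma int_cauchy_schwarz (f : R -> R) (u v : R) : u <= v -> cont f ->
  int f u v ^ 2 <= (v - u) * int (fun t => f t ^ 2) u v.
Proof.
  intros Huv Hf.
  destruct (Req_dec u v) as [<-|Hne].
  { rewrite !int_point. lra. }
  set (c := int f u v / (v - u)).
  assert (H : 0 <= int (fun t => (f t ^ 2 + (- 2 * c) * f t) + c ^ 2) u v).
  { apply int_ge0; ct. intros t _. replace (f t ^ 2 + -2 * c * f t + c ^ 2)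
      with ((f t - c) ^ 2) by ring. apply pow2_ge_0. }
  rewrite int_plus, int_plus, int_scal, int_const in H by (ct).
  assert (E : int f u v = c * (v - u)) by (unfold c; field; lra).
  set (I := int (fun t => f t ^ 2) u v) in *. rewrite E in H |- *.
  assert (c ^ 2 * (v - u) <= I) by nra.
  assert (0 < v - u) by lra. nra.
Qed.

Lemma int_shift (f : R -> R) (k u v : R) : cont f ->
  int (fun t => f (t + k)) u v = int f (u + k) (v + k).
Proof.
  intros Hf. unfold int.
  pose proof (RInt_comp_lin f 1 k u v) as H.
  rewrite !Rmult_1_l in H. rewrite <- H by now apply int_ex.
  apply RInt_ext. intros t _. change (f (t + k) = 1 * f (1 * t + k)). now rewrite !Rmult_1_l.
Qed.

Lemma int_reflect (f : R -> R) (u v : R) : cont f ->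
  int (fun t => f (- t)) u v = int f (- v) (- u).
Proof.
  intros Hf.
  pose proof (RInt_comp_lin f (-1) 0 u v (int_ex f _ _ Hf)) as H.
  replace (-1 * u + 0) with (- u) in H by ring.
  replace (-1 * v + 0) with (- v) in H by ring.
  pose proof (int_chasles f (-u) (-v) (-u) Hf) as E. rewrite int_point in E.
  fold (int f (- u) (- v)) in H.
  assert (E2 : int (fun y => scal (-1) (f (-1 * y + 0))) u v = -1 * int (fun t => f (- t)) u v).
  { rewrite <- int_scal by ct.
    unfold int. apply RInt_ext. intros t _. replace (-1 * t + 0) with (- t) by ring. reflexivity. }
  assert (E3 : -1 * int (fun t => f (- t)) u v = int f (- u) (- v)) by exact (eq_trans (eq_sym E2) H).
  lra.
Qed.

Lemma derive_mono (f df : R -> R) (u v : R) : u <= v ->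
  (forall t, is_derive f t (df t)) -> (forall t, u <= t <= v -> 0 <= df t) ->
  f u <= f v.
Proof.
  intros Huv Hf H.
  destruct (MVT_gen f u v df) as [c [Hc E]].
  - intros; apply Hf.
  - intros. apply cont_pt. now apply cont_derive with df.
  - rewrite Rmin_left, Rmax_right in Hc by lra. specialize (H c Hc). nra.
Qed.

Lemma cont_max (f : R -> R) (u v : R) : u <= v -> cont f ->
  exists s, u <= s <= v /\ forall t, u <= t <= v -> f t <= f s.
Proof.
  intros Huv Hf. destruct (continuity_ab_maj f u v Huv) as [s [H1 H2]].
  - intros; now apply cont_pt.
  - exists s; auto.
Qed.

Lemma cont_min (f : R -> R) (u v : R) : u <= v -> cont f ->
  exists s, u <= s <= v /\ forall t, u <= t <= v -> f s <= f t.
Proof.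
  intros Huv Hf. destruct (cont_max (fun t => - f t) u v Huv) as [s [H1 H2]]; [ct|].
  exists s. split; auto. intros t Ht. specialize (H2 t Ht). lra.
Qed.

Lemma cont_ivt (f : R -> R) (u v y : R) : u <= v -> cont f -> f u <= y <= f v ->
  exists s, u <= s <= v /\ f s = y.
Proof.
  intros Huv Hf Hy.
  destruct (IVT_gen f u v y) as [s [Hs E]].
  - intros t. now apply cont_pt.
  - rewrite Rmin_left, Rmax_right by lra. exact Hy.
  - rewrite Rmin_left, Rmax_right in Hs by lra. now exists s.
Qed.

(** * Extraction of locally uniformly convergent subsequences *)

Definition increasing_seq (phi : nat -> nat) : Prop := forall n, (phi n < phi (S n))%nat.

Lemma increasing_seq_lt (phi : nat -> nat) (m n : nat) :
  increasing_seq phi -> (m < n)%nat -> (phi m < phi n)%nat.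
Proof.
  intros H Hmn. induction Hmn as [|n _ IH].
  - apply H.
  - specialize (H n). lia.
Qed.

Lemma increasing_seq_ge (phi : nat -> nat) (n : nat) :
  increasing_seq phi -> (n <= phi n)%nat.
Proof.
  intros H. induction n as [|n IH]; [lia|]. specialize (H n). lia.
Qed.

Lemma lim_seq_eps (u : nat -> R) (l e : R) : is_lim_seq u l -> 0 < e ->
  exists N, forall n, (N <= n)%nat -> Rabs (u n - l) < e.
Proof.
  intros H He. apply is_lim_seq_spec in H. exact (H (mkposreal e He)).
Qed.

Lemma lim_seq_of_eps (u : nat -> R) (l : R) :
  (forall e, 0 < e -> exists N, forall n, (N <= n)%nat -> Rabs (u n - l) < e) ->
  is_lim_seq u l.
Proof. intros H. apply is_lim_seq_spec. intros [e He]. exact (H e He). Qed.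

Lemma archimedean_inv (e : R) : 0 < e ->
  exists N, forall n, (N <= n)%nat -> / (INR n + 1) < e.
Proof.
  intros He. destruct (archimed_cor1 e He) as [N [H HN]].
  exists N. intros n Hn. eapply Rle_lt_trans; [|exact H].
  assert (0 < INR N) by now apply lt_0_INR.
  apply le_INR in Hn. apply Rinv_le_contravar; lra.
Qed.

(** Boundedness makes the limit superior finite, and it is approached at arbitrarily late indices.
    Choice picks for each [(N, k)] an index past [N] within [/ (k + 1)] of it; the recursion [phi]
    restarts past its previous value. *)
Lemma bounded_subseq_cv (u : nat -> R) (C : R) : (forall n, Rabs (u n) <= C) ->
  exists phi, increasing_seq phi /\ ex_finite_lim_seq (fun n => u (phi n)).
Proof.
  intros HC.
  assert (HC' : forall n, - C <= u n <= C) by (intros n; now apply Rabs_le_between).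
  destruct (ex_LimSup_seq u) as [l Hl].
  assert (Hfin : exists l0 : R, is_LimSup_seq u l0).
  { destruct l as [l| |].
    - now exists l.
    - destruct (Hl C 0%nat) as [n [_ Hn]]. specialize (HC' n). lra.
    - destruct (Hl (- C)) as [N HN]. specialize (HN N (le_n N)).
      specialize (HC' N). lra. }
  clear l Hl. destruct Hfin as [l Hl].
  assert (Hcl : forall p : nat * nat, exists n, (fst p <= n)%nat /\
    Rabs (u n - l) < / (INR (snd p) + 1)).
  { intros [N k]. assert (He : 0 < / (INR k + 1)).
    { apply Rinv_0_lt_compat. pose proof (pos_INR k). lra. }
    destruct (Hl (mkposreal _ He)) as [H1 [N2 H2]]. simpl in H1, H2.
    destruct (H1 (Nat.max N N2)) as [n [Hn Hu]].
    exists n. split; [simpl; lia|].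
    specialize (H2 n ltac:(lia)). apply Rabs_def1; simpl; lra. }
  apply choice in Hcl. destruct Hcl as [psi Hpsi].
  set (phi := fix phi k := match k with
    | O => psi (O, O) | S k' => psi (S (phi k'), S k') end).
  exists phi. split.
  - intros n. destruct (Hpsi (S (phi n), S n)) as [H _]. exact H.
  - exists l. apply lim_seq_of_eps. intros e He.
    destruct (archimedean_inv e He) as [N HN]. exists N. intros n Hn.
    eapply Rlt_trans; [|exact (HN n Hn)].
    destruct n as [|n]; [apply (Hpsi (0, 0)%nat)|apply (Hpsi (S (phi n), S n))].
Qed.

Lemma diagonal_subseq (u : nat -> nat -> R) (C : R) :
  (forall n k, Rabs (u n k) <= C) ->
  exists sigma, increasing_seq sigma /\
    forall k, ex_finite_lim_seq (fun n => u (sigma n) k).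
Proof.
  intros HC.
  assert (Hstep : forall p : (nat -> nat) * nat, exists psi, increasing_seq psi /\
    ex_finite_lim_seq (fun n => u (fst p (psi n)) (snd p))).
  { intros [phi k]. apply (bounded_subseq_cv (fun n => u (phi n) k) C). auto. }
  apply choice in Hstep. destruct Hstep as [psi Hpsi].
  set (Phi := fix Phi k := match k with
    | O => fun n => n
    | S k' => fun n => Phi k' (psi (Phi k', k') n) end).
  assert (Hinc : forall k, increasing_seq (Phi k)).
  { induction k as [|k IH]; intros n; simpl; [lia|].
    apply increasing_seq_lt; auto. apply Hpsi. }
  (* Each row [Phi (d + k)] is a subsequence of the row [Phi k], and never runs behind it. Hence the
     diagonal is, from index [S k] on, drawn from the row [Phi (S k)], along which column [k]
     converges. *)
  assert (Hsub : forall k d n, exists j, (n <= j)%nat /\ Phi (d + k)%nat n = Phi k j).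
  { intros k d. induction d as [|d IH]; intros n; simpl.
    - exists n. auto.
    - destruct (IH (psi (Phi (d + k)%nat, (d + k)%nat) n)) as [j [Hj E]].
      exists j. split; [|exact E].
      eapply Nat.le_trans; [|exact Hj]. apply increasing_seq_ge. apply Hpsi. }
  exists (fun n => Phi n n). split.
  - intros n. simpl.
    eapply Nat.lt_le_trans; [apply (Hinc n n)|].
    destruct (Nat.eq_dec (S n) (psi (Phi n, n) (S n))) as [E|E].
    + rewrite <- E. lia.
    + apply Nat.lt_le_incl, increasing_seq_lt; auto.
      pose proof (increasing_seq_ge (psi (Phi n, n)) (S n) (proj1 (Hpsi (Phi n, n)))). lia.
  - intros k. destruct (Hpsi (Phi k, k)) as [_ [l Hl]]. exists l.
    apply lim_seq_of_eps. intros e He.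
    destruct (lim_seq_eps _ _ _ Hl He) as [N HN].
    exists (Nat.max N (S k)). intros n Hn.
    destruct (Hsub (S k) (n - S k)%nat n) as [j [Hj E]].
    replace (n - S k + S k)%nat with n in E by lia. rewrite E.
    apply (HN j). lia.
Qed.

(** Pairs are decoded twice: [i - j] is the signed numerator and [m + 1] the nonzero denominator. *)
Definition rational_enum (k : nat) : R :=
  let (p, m) := Cantor.of_nat k in
  let (i, j) := Cantor.of_nat p in (INR i - INR j) / (INR m + 1).

Lemma rational_enum_dense (t r : R) : 0 < r -> exists k, Rabs (t - rational_enum k) < r.
Proof.
  intros Hr. destruct (archimedean_inv r Hr) as [m Hm]. specialize (Hm m (le_n m)).
  pose proof (pos_INR m) as Hm0.
  set (z := up (t * (INR m + 1))).
  exists (Cantor.to_nat (Cantor.to_nat (Z.to_nat z, Z.to_nat (- z)), m)).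
  unfold rational_enum. rewrite !Cantor.cancel_of_to.
  assert (E : INR (Z.to_nat z) - INR (Z.to_nat (- z)) = IZR z).
  { rewrite !INR_IZR_INZ, <- minus_IZR. f_equal. lia. }
  rewrite E. eapply Rle_lt_trans; [|exact Hm].
  destruct (archimed (t * (INR m + 1))) as [H1 H2]. fold z in H1, H2.
  replace (t - IZR z / (INR m + 1)) with ((t * (INR m + 1) - IZR z) * / (INR m + 1))
    by (field; lra).
  assert (0 < / (INR m + 1)) by (apply Rinv_0_lt_compat; lra).
  rewrite Rabs_mult, (Rabs_pos_eq (/ _)) by lra.
  rewrite <- (Rmult_1_l (/ (INR m + 1))) at 2.
  apply Rmult_le_compat_r; [lra|]. apply Rabs_le. lra.
Qed.

(** Convergence on the rationals spreads to every point by equicontinuity. The subsequence stays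
    hidden in the conclusion, because every later use needs only one sufficiently late index that is
    good on one compact interval. *)
Lemma ascoli (f : nat -> R -> R) (C : R) :
  (forall n t, Rabs (f n t) <= C) ->
  (forall e, 0 < e -> exists r, 0 < r /\
     forall n s t, Rabs (s - t) <= r -> Rabs (f n s - f n t) <= e) ->
  exists g, forall N e n0, 0 < e ->
    exists n, (n0 <= n)%nat /\ forall t, Rabs t <= N -> Rabs (f n t - g t) <= e.
Proof.
  intros HC Heq.
  destruct (diagonal_subseq (fun n k => f n (rational_enum k)) C) as [sigma [Hs Hq]].
  { intros; apply HC. }
  assert (Hpt : forall t, ex_finite_lim_seq (fun n => f (sigma n) t)).
  { intros t. apply ex_lim_seq_cauchy_corr. intros [e He]. simpl.
    destruct (Heq (e / 4) ltac:(lra)) as [r [Hr Hr']].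
    destruct (rational_enum_dense t r Hr) as [k Hk].
    destruct (Hq k) as [l Hl].
    destruct (lim_seq_eps _ _ (e / 5) Hl ltac:(lra)) as [N HN].
    exists N. intros n m Hn Hm.
    pose proof (HN n Hn) as A1. pose proof (HN m Hm) as A2.
    pose proof (Hr' (sigma n) t (rational_enum k) ltac:(lra)) as A3.
    pose proof (Hr' (sigma m) t (rational_enum k) ltac:(lra)) as A4.
    apply Rabs_def2 in A1, A2. apply Rabs_le_between in A3, A4.
    apply Rabs_def1; lra. }
  set (g := fun t => real (Lim_seq (fun n => f (sigma n) t))).
  assert (Hg : forall t, is_lim_seq (fun n => f (sigma n) t) (g t)).
  { intros t. apply Lim_seq_correct', Hpt. }
  exists g. intros N e n0 He.
  destruct (Heq (e / 4) ltac:(lra)) as [r [Hr Hr']].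
  assert (Hgr : forall s t, Rabs (s - t) <= r -> Rabs (g s - g t) <= e / 3).
  { intros s t Hst.
    destruct (lim_seq_eps _ _ (e / 24) (Hg s) ltac:(lra)) as [n1 H1].
    destruct (lim_seq_eps _ _ (e / 24) (Hg t) ltac:(lra)) as [n2 H2].
    specialize (H1 (Nat.max n1 n2) ltac:(lia)). specialize (H2 (Nat.max n1 n2) ltac:(lia)).
    pose proof (Hr' (sigma (Nat.max n1 n2)) s t Hst) as A.
    apply Rabs_def2 in H1, H2. apply Rabs_le_between in A.
    apply Rabs_le; lra. }
  (* Pointwise convergence becomes uniform on [[- N, N]] through a grid of mesh [r]: finitely many
     grid points share one threshold, and the moduli of [f] and [g] cover the gaps, with total error
     [e / 3 + e / 4 + e / 3]. *)
  assert (Hgrid : forall M : nat, exists m, forall n, (m <= n)%nat -> forall i, (i <= M)%nat ->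
    Rabs (f (sigma n) (- N + INR i * r) - g (- N + INR i * r)) <= e / 3).
  { induction M as [|M [m IH]].
    - destruct (lim_seq_eps _ _ (e / 3) (Hg (- N + INR 0 * r)) ltac:(lra)) as [m Hm].
      exists m. intros n Hn i Hi. replace i with 0%nat by lia.
      now apply Rlt_le, Hm.
    - destruct (lim_seq_eps _ _ (e / 3) (Hg (- N + INR (S M) * r)) ltac:(lra)) as [m' Hm'].
      exists (Nat.max m m'). intros n Hn i Hi.
      destruct (Nat.eq_dec i (S M)) as [->|Hne].
      + apply Rlt_le, Hm'. lia.
      + apply IH; lia. }
  destruct (Rlt_dec N 0) as [HN|HN].
  { exists n0. split; [lia|]. intros t Ht. pose proof (Rabs_pos t). lra. }
  assert (HNr : 0 <= 2 * N / r).
  { apply Rmult_le_pos; [lra|]. apply Rlt_le, Rinv_0_lt_compat; lra. }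
  destruct (nfloor_ex (2 * N / r) HNr) as [M HM].
  destruct (Hgrid (S M)) as [m Hm].
  exists (sigma (Nat.max m n0)). split.
  { pose proof (increasing_seq_ge sigma (Nat.max m n0) Hs). lia. }
  intros t Ht. apply Rabs_le_between in Ht.
  assert (Hi0 : 0 <= (t + N) / r).
  { apply Rmult_le_pos; [lra|]. apply Rlt_le, Rinv_0_lt_compat; lra. }
  destruct (nfloor_ex ((t + N) / r) Hi0) as [i [Hi1 Hi2]].
  assert (Et : (t + N) = (t + N) / r * r) by (field; lra).
  assert (HiM : (i <= S M)%nat).
  { apply INR_le. rewrite S_INR.
    assert ((t + N) / r <= 2 * N / r).
    { apply Rmult_le_compat_r; [|lra]. apply Rlt_le, Rinv_0_lt_compat; lra. }
    lra. }
  specialize (Hm (Nat.max m n0) ltac:(lia) i HiM).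
  assert (Hti : Rabs (t - (- N + INR i * r)) <= r) by (apply Rabs_le; nra).
  pose proof (Hr' (sigma (Nat.max m n0)) _ _ Hti) as A.
  pose proof (Hgr _ _ Hti) as B.
  apply Rabs_le_between in Hm, A, B. apply Rabs_le; lra.
Qed.

(** * Paths and their action *)

Definition clip (lo hi x : R) : R := Rmax lo (Rmin hi x).

Lemma clip_lipschitz (lo hi x y : R) :
  Rabs (clip lo hi x - clip lo hi y) <= Rabs (x - y).
Proof.
  unfold clip, Rmax, Rmin.
  repeat destruct Rle_dec; unfold Rabs; repeat destruct Rcase_abs; lra.
Qed.

Lemma clip_bounds (lo hi x : R) : lo <= hi -> lo <= clip lo hi x <= hi.
Proof. intros H. unfold clip, Rmax, Rmin. repeat destruct Rle_dec; lra. Qed.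

Lemma clip_in (lo hi x : R) : lo <= x <= hi -> clip lo hi x = x.
Proof. intros H. unfold clip, Rmax, Rmin. repeat destruct Rle_dec; lra. Qed.

Lemma clip_low (lo hi x : R) : lo <= hi -> x <= lo -> clip lo hi x = lo.
Proof. intros H H'. unfold clip, Rmax, Rmin. repeat destruct Rle_dec; lra. Qed.

Lemma clip_high (lo hi x : R) : lo <= hi -> hi <= x -> clip lo hi x = hi.
Proof. intros H H'. unfold clip, Rmax, Rmin. repeat destruct Rle_dec; lra. Qed.

Lemma cont_clip (lo hi : R) : cont (clip lo hi).
Proof.
  apply cont_lipschitz with 1. intros s t. rewrite Rmult_1_l. apply clip_lipschitz.
Qed.

(** On [[0, 1]] this is the derivative of [3 t ^ 2 - 2 t ^ 3]. It vanishes at both ends, so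
    truncating the argument gives one continuous formula on the whole line and a C^1 transition from
    0 to 1. *)
Definition dstep (t : R) : R := 6 * (clip 0 1 t * (1 - clip 0 1 t)).
Definition step (t : R) : R := int dstep 0 t.

Lemma cont_dstep : cont dstep.
Proof. pose proof (cont_clip 0 1). unfold dstep. ct. Qed.

Lemma dstep_bounds (t : R) : 0 <= dstep t <= 2.
Proof.
  unfold dstep. pose proof (clip_bounds 0 1 t ltac:(lra)).
  set (c := clip 0 1 t) in *.
  assert (0 <= (c - / 2) ^ 2) by apply pow2_ge_0. nra.
Qed.

Lemma step_derive (t : R) : is_derive step t (dstep t).
Proof. apply derive_int, cont_dstep. Qed.

Lemma cont_step : cont step.
Proof. apply cont_derive with dstep, step_derive. Qed.

Lemma step_low (t : R) : t <= 0 -> step t = 0.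
Proof.
  intros Ht. unfold step.
  pose proof (int_chasles dstep 0 t 0 cont_dstep) as E. rewrite int_point in E.
  assert (H : int dstep t 0 = int (fun _ => 0) t 0).
  { apply int_ext; auto. intros s Hs. unfold dstep. rewrite clip_low; lra. }
  rewrite int_const in H. lra.
Qed.

Lemma step_high (t : R) : 1 <= t -> step t = 1.
Proof.
  intros Ht. unfold step.
  rewrite <- (int_chasles dstep 0 1 t) by apply cont_dstep.
  assert (H : int dstep 1 t = int (fun _ => 0) 1 t).
  { apply int_ext; auto. intros s Hs. unfold dstep. rewrite clip_high; lra. }
  assert (H' : int dstep 0 1 = int (fun s => 6 * (s * (1 - s))) 0 1).
  { apply int_ext; [lra|]. intros s Hs. unfold dstep. rewrite clip_in; lra. }
  rewrite (int_derive (fun s => 3 * s ^ 2 - 2 * s ^ 3) (fun s => 6 * (s * (1 - s)))) in H'.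
  - cbv beta in H'. rewrite int_const in H. lra.
  - intros s. auto_derive; [exact I|ring].
  - ct.
Qed.

Lemma step_bounds (t : R) : 0 <= step t <= 1.
Proof.
  assert (M : forall u v, u <= v -> step u <= step v).
  { intros u v Huv. apply (derive_mono step dstep); auto using step_derive.
    intros; apply dstep_bounds. }
  split.
  - destruct (Rle_dec t 0); [rewrite step_low; lra|].
    rewrite <- (step_low 0) by lra. apply M; lra.
  - destruct (Rle_dec 1 t); [rewrite step_high; lra|].
    rewrite <- (step_high 1) by lra. apply M; lra.
Qed.

(** [pot_lower] is the coercivity that keeps paths of bounded action bounded. Its right-hand side is
    the tangent of [(r - 1) ^ 2] at [r = 2], taken at [r = Rabs x], so squared distances to the
    wells satisfy it. *)
Record potential (W w : R -> R) (L : R) : Prop := {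
  pot_derive : forall x, is_derive W x (w x);
  pot_lipschitz : forall x y, Rabs (w x - w y) <= L * Rabs (x - y);
  pot_nonneg : forall x, 0 <= W x;
  pot_m1 : W (-1) = 0;
  pot_1 : W 1 = 0;
  pot_pos : forall x, x <> -1 -> x <> 1 -> 0 < W x;
  pot_lower : forall x, 2 * Rabs x - 3 <= W x
}.

Record coefficient (b : R -> R) (b0 B : R) : Prop := {
  coef_cont : cont b;
  coef_pos : 0 < b0;
  coef_bounds : forall t, b0 <= b t <= B
}.

(** Being exactly constant beyond [K] makes the action over [[- K, K]] the total action. [K] is a
    bound and not part of the path: it may be enlarged freely. *)
Record path (x dx : R -> R) (K : R) : Prop := {
  path_derive : forall t, is_derive x t (dx t);
  path_dcont : cont dx;
  path_left : forall t, t <= - K -> x t = -1;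
  path_right : forall t, K <= t -> x t = 1
}.

Definition lagrangian (W b x dx : R -> R) (t : R) : R := dx t ^ 2 / 2 + b t * W (x t).

Definition action (W b x dx : R -> R) (u v : R) : R := int (lagrangian W b x dx) u v.

Lemma pot_cont (W w : R -> R) (L : R) : potential W w L -> cont W.
Proof. intros H. exact (cont_derive W w (pot_derive _ _ _ H)). Qed.

Lemma pot_dcont (W w : R -> R) (L : R) : potential W w L -> cont w.
Proof. intros H. exact (cont_lipschitz w L (pot_lipschitz _ _ _ H)). Qed.

Lemma pot_L_nonneg (W w : R -> R) (L : R) : potential W w L -> 0 <= L.
Proof.
  intros H. pose proof (pot_lipschitz _ _ _ H 1 0) as E.
  rewrite Rminus_0_r, Rabs_R1 in E. pose proof (Rabs_pos (w 1 - w 0)). lra.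
Qed.

Lemma path_cont (x dx : R -> R) (K : R) : path x dx K -> cont x.
Proof. intros H. exact (cont_derive x dx (path_derive _ _ _ H)). Qed.

Lemma path_pos (x dx : R -> R) (K : R) : path x dx K -> 0 < K.
Proof.
  intros H. destruct (Rlt_dec 0 K) as [|HK]; auto.
  pose proof (path_left _ _ _ H K ltac:(lra)).
  pose proof (path_right _ _ _ H K ltac:(lra)). lra.
Qed.

Lemma path_widen (x dx : R -> R) (K K' : R) : K <= K' -> path x dx K -> path x dx K'.
Proof. intros HK [H1 H2 H3 H4]. split; auto; intros; [apply H3|apply H4]; lra. Qed.

Lemma derive_zero_of_locally_const (x : R -> R) (d t u v c : R) : u < t < v ->
  is_derive x t d -> (forall s, u < s < v -> x s = c) -> d = 0.
Proof.
  intros Ht Hx Hc.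
  assert (H0 : is_derive x t 0).
  { apply (is_derive_ext_loc (fun _ => c)); [|apply is_derive_Reals, derivable_pt_lim_const].
    assert (Hr : 0 < Rmin (t - u) (v - t)) by (apply Rmin_glb_lt; lra).
    exists (mkposreal _ Hr). intros s Hs. change (Rabs (s - t) < Rmin (t - u) (v - t)) in Hs.
    symmetry. apply Hc. pose proof (Rmin_l (t - u) (v - t)). pose proof (Rmin_r (t - u) (v - t)).
    apply Rabs_def2 in Hs. lra. }
  apply is_derive_unique in Hx. apply is_derive_unique in H0. lra.
Qed.

Lemma path_dleft (x dx : R -> R) (K t : R) : path x dx K -> t < - K -> dx t = 0.
Proof.
  intros H Ht. apply (derive_zero_of_locally_const x (dx t) t (t - 1) (- K) (-1)); [lra|apply H|].
  intros; apply H; lra.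
Qed.

Lemma path_dright (x dx : R -> R) (K t : R) : path x dx K -> K < t -> dx t = 0.
Proof.
  intros H Ht. apply (derive_zero_of_locally_const x (dx t) t K (t + 1) 1); [lra|apply H|].
  intros; apply H; lra.
Qed.

Lemma lagrangian_cont (W b x dx : R -> R) :
  cont W -> cont b -> cont x -> cont dx -> cont (lagrangian W b x dx).
Proof. intros. unfold lagrangian. ct. Qed.

Lemma lagrangian_nonneg (W w b x dx : R -> R) (L b0 B t : R) :
  potential W w L -> coefficient b b0 B -> 0 <= lagrangian W b x dx t.
Proof.
  intros HW Hb. unfold lagrangian.
  pose proof (pow2_ge_0 (dx t)). pose proof (pot_nonneg _ _ _ HW (x t)).
  pose proof (coef_bounds _ _ _ Hb t). pose proof (coef_pos _ _ _ Hb). nra.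
Qed.

Lemma path_lagrangian_cont (W w b x dx : R -> R) (L b0 B K : R) :
  potential W w L -> coefficient b b0 B -> path x dx K -> cont (lagrangian W b x dx).
Proof.
  intros HW Hb Hx. apply lagrangian_cont.
  - eapply pot_cont; eauto.
  - apply Hb.
  - eapply path_cont; eauto.
  - apply Hx.
Qed.

Lemma action_widen (W w b x dx : R -> R) (L b0 B K K' : R) :
  potential W w L -> coefficient b b0 B -> path x dx K -> K <= K' ->
  action W b x dx (- K') K' = action W b x dx (- K) K.
Proof.
  intros HW Hb Hx HK.
  pose proof (path_lagrangian_cont W w b x dx L b0 B K HW Hb Hx) as Hc.
  unfold action.
  rewrite <- (int_chasles _ (- K') (- K) K'), <- (int_chasles _ (- K) K K') by assumption.
  assert (E1 : int (lagrangian W b x dx) (- K') (- K) = int (fun _ => 0) (- K') (- K)).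
  { apply int_ext; [lra|]. intros t Ht. unfold lagrangian.
    rewrite (path_dleft x dx K), (path_left x dx K) by (auto; lra).
    rewrite (pot_m1 _ _ _ HW). field. }
  assert (E2 : int (lagrangian W b x dx) K K' = int (fun _ => 0) K K').
  { apply int_ext; [lra|]. intros t Ht. unfold lagrangian.
    rewrite (path_dright x dx K), (path_right x dx K) by (auto; lra).
    rewrite (pot_1 _ _ _ HW). field. }
  rewrite int_const in E1, E2. lra.
Qed.

Lemma action_sub (W w b x dx : R -> R) (L b0 B K u v : R) :
  potential W w L -> coefficient b b0 B -> path x dx K -> u <= v ->
  action W b x dx u v <= action W b x dx (- K) K.
Proof.
  intros HW Hb Hx Huv.
  set (K' := Rmax K (Rmax (- u) v)).
  assert (K <= K' /\ - u <= K' /\ v <= K') as (H1 & H2 & H3).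
  { unfold K'. pose proof (Rmax_l K (Rmax (- u) v)). pose proof (Rmax_r K (Rmax (- u) v)).
    pose proof (Rmax_l (- u) v). pose proof (Rmax_r (- u) v). lra. }
  rewrite <- (action_widen W w b x dx L b0 B K K') by assumption.
  apply int_subinterval; try lra.
  - now apply (path_lagrangian_cont W w b x dx L b0 B K).
  - intros. now apply (lagrangian_nonneg W w b x dx L b0 B).
Qed.

Lemma action_nonneg (W w b x dx : R -> R) (L b0 B K : R) :
  potential W w L -> coefficient b b0 B -> path x dx K ->
  0 <= action W b x dx (- K) K.
Proof.
  intros HW Hb Hx. pose proof (path_pos _ _ _ Hx).
  apply int_ge0; [lra| |].
  - now apply (path_lagrangian_cont W w b x dx L b0 B K).
  - intros. now apply (lagrangian_nonneg W w b x dx L b0 B).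
Qed.

(** Cauchy-Schwarz applied to [dx], whose kinetic energy is at most the action because the potential
    part is nonnegative. *)
Lemma action_holder (W w b x dx : R -> R) (L b0 B K M s t : R) :
  potential W w L -> coefficient b b0 B -> path x dx K ->
  action W b x dx (- K) K <= M ->
  (x s - x t) ^ 2 <= 2 * M * Rabs (s - t).
Proof.
  intros HW Hb Hx HM.
  assert (Hst : forall s t, s <= t -> (x t - x s) ^ 2 <= 2 * M * (t - s)).
  { clear s t. intros s t Hst.
    pose proof (path_dcont _ _ _ Hx) as Hdx.
    rewrite <- (int_derive x dx s t) by (apply Hx).
    eapply Rle_trans; [now apply int_cauchy_schwarz|].
    rewrite (Rmult_comm (2 * M)). apply Rmult_le_compat_l; [lra|].
    assert (E : int (fun r => dx r ^ 2) s t = 2 * int (fun r => / 2 * dx r ^ 2) s t).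
    { rewrite int_scal by ct. field. }
    rewrite E. apply Rmult_le_compat_l; [lra|].
    eapply Rle_trans; [|exact HM].
    eapply Rle_trans; [|now apply (action_sub W w b x dx L b0 B K s t)].
    apply int_le; auto.
    - ct.
    - now apply (path_lagrangian_cont W w b x dx L b0 B K).
    - intros r _. unfold lagrangian. pose proof (pot_nonneg _ _ _ HW (x r)).
      pose proof (coef_bounds _ _ _ Hb r). pose proof (coef_pos _ _ _ Hb). nra. }
  destruct (Rle_dec s t) as [H|H].
  - rewrite Rabs_left1 by lra. specialize (Hst s t H). nra.
  - rewrite Rabs_pos_eq by lra. apply Hst. lra.
Qed.

(** A path that is large at [t] stays large on [[t, t + 1]], where coercivity then makes the
    potential energy exceed [M]. The term [2 * M + 1] bounds the Hoelder oscillation, at most the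
    square root of [2 * M], over unit time. *)
Lemma action_bounded (W w b x dx : R -> R) (L b0 B K M t : R) :
  potential W w L -> coefficient b b0 B -> path x dx K ->
  action W b x dx (- K) K <= M ->
  Rabs (x t) <= M / b0 + 2 + (2 * M + 1).
Proof.
  intros HW Hb Hx HM.
  pose proof (coef_pos _ _ _ Hb) as Hb0.
  pose proof (action_nonneg _ _ _ _ _ _ _ _ _ HW Hb Hx) as HM0.
  assert (H : b0 * (2 * (Rabs (x t) - (2 * M + 1)) - 3) * (t + 1 - t) <= M).
  { eapply Rle_trans; [|exact HM].
    eapply Rle_trans; [|apply (action_sub W w b x dx L b0 B K t (t + 1)); auto; lra].
    apply int_ge_const; [lra|now apply (path_lagrangian_cont W w b x dx L b0 B K)|].
    intros s Hs. unfold lagrangian.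
    pose proof (action_holder W w b x dx L b0 B K M s t HW Hb Hx HM) as Hh.
    rewrite (Rabs_pos_eq (s - t)) in Hh by lra.
    assert (Hd : Rabs (x s - x t) <= 2 * M + 1).
    { apply Rabs_le. split; nra. }
    assert (Ht : Rabs (x t) <= Rabs (x s) + (2 * M + 1)).
    { revert Hd. unfold Rabs; repeat destruct Rcase_abs; lra. }
    pose proof (pot_lower _ _ _ HW (x s)). pose proof (pow2_ge_0 (dx s)).
    pose proof (coef_bounds _ _ _ Hb s). pose proof (pot_nonneg _ _ _ HW (x s)).
    assert (b0 * W (x s) <= b s * W (x s)) by nra.
    assert (b0 * (2 * (Rabs (x t) - (2 * M + 1)) - 3) <= b0 * W (x s)) by nra.
    lra. }
  assert (E : M = b0 * (M / b0)) by (field; lra).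
  replace (t + 1 - t) with 1 in H by ring. rewrite Rmult_1_r in H.
  rewrite E in H at 2. apply Rmult_le_reg_l in H; [|exact Hb0].
  assert (0 <= M / b0). { apply Rmult_le_pos; [lra|]. apply Rlt_le, Rinv_0_lt_compat; lra. }
  lra.
Qed.

Definition min_level (W b : R -> R) (m : R) : Prop :=
  (forall x dx K, path x dx K -> m <= action W b x dx (- K) K) /\
  (forall e, 0 < e -> exists x dx K, path x dx K /\ action W b x dx (- K) K < m + e).

Lemma path_exists : path (fun t => 2 * step t - 1) (fun t => 2 * dstep t) 1.
Proof.
  split.
  - intros t. pose proof (step_derive t) as H.
    apply is_derive_Reals. apply is_derive_Reals in H.
    replace (2 * dstep t) with (2 * dstep t - 0) by ring.
    apply (derivable_pt_lim_minus (fun t => 2 * step t) (fun _ => 1)).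
    + now apply (derivable_pt_lim_scal step).
    + apply derivable_pt_lim_const.
  - pose proof cont_dstep. ct.
  - intros t Ht. rewrite step_low; lra.
  - intros t Ht. rewrite step_high; lra.
Qed.

Lemma min_level_exists (W w b : R -> R) (L b0 B : R) :
  potential W w L -> coefficient b b0 B -> exists m, 0 <= m /\ min_level W b m.
Proof.
  intros HW Hb.
  (* Completeness provides least upper bounds, hence the change of sign. *)
  set (S := fun r => exists x dx K, path x dx K /\ r = - action W b x dx (- K) K).
  destruct (completeness S) as [l [Hl1 Hl2]].
  - exists 0. intros r (x & dx & K & Hx & ->).
    pose proof (action_nonneg _ _ _ _ _ _ _ _ _ HW Hb Hx). lra.
  - eexists. do 3 eexists. split; [exact path_exists|reflexivity].
  - exists (- l). split; [|split].
    + assert (l <= 0); [|lra]. apply Hl2. intros r (x & dx & K & Hx & ->).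
      pose proof (action_nonneg _ _ _ _ _ _ _ _ _ HW Hb Hx). lra.
    + intros x dx K Hx.
      assert (- action W b x dx (- K) K <= l); [|lra]. apply Hl1. now exists x, dx, K.
    + intros e He. apply NNPP. intros Hn.
      assert (l <= l - e); [|lra]. apply Hl2. intros r (x & dx & K & Hx & ->).
      apply Rnot_lt_le. intros Hlt. apply Hn. exists x, dx, K. split; auto. lra.
Qed.

(** * Comparison of the minimal levels *)

Lemma derive_zero_at_min (f : R -> R) (t d : R) :
  is_derive f t d -> (forall s, f t <= f s) -> d = 0.
Proof.
  intros Hf Hmin. apply is_derive_Reals in Hf.
  rewrite <- (deriv_minimum f (t - 1) (t + 1) t (exist _ d Hf)); auto; lra.
Qed.

(** A substitute for the second-order Taylor formula, as [w] is only Lipschitz. A single use of the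
    mean value theorem gives the constant [L] in place of [L / 2]. *)
Lemma pot_quadratic (W w : R -> R) (L x y : R) : potential W w L ->
  Rabs (W y - W x - w x * (y - x)) <= L * (y - x) ^ 2.
Proof.
  intros HW.
  destruct (MVT_gen W x y w) as [c [Hc E]].
  - intros; apply HW.
  - intros. apply cont_pt. eapply pot_cont; eauto.
  - rewrite E. replace (w c * (y - x) - w x * (y - x)) with ((w c - w x) * (y - x)) by ring.
    rewrite Rabs_mult.
    assert (Hcx : Rabs (c - x) <= Rabs (y - x)).
    { revert Hc. unfold Rmin, Rmax, Rabs.
      destruct Rle_dec; destruct Rcase_abs; destruct Rcase_abs; lra. }
    pose proof (pot_lipschitz _ _ _ HW c x) as Hl. pose proof (pot_L_nonneg _ _ _ HW).
    assert (E2 : L * (y - x) ^ 2 = (L * Rabs (y - x)) * Rabs (y - x)).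
    { rewrite <- (pow2_abs (y - x)). ring. }
    rewrite E2. apply Rmult_le_compat_r; [apply Rabs_pos|].
    eapply Rle_trans; [exact Hl|]. now apply Rmult_le_compat_l.
Qed.

Lemma pot_dm1 (W w : R -> R) (L : R) : potential W w L -> w (-1) = 0.
Proof.
  intros HW. apply (derive_zero_at_min W (-1)); [apply HW|].
  intros s. rewrite (pot_m1 _ _ _ HW). apply HW.
Qed.

Lemma pot_d1 (W w : R -> R) (L : R) : potential W w L -> w 1 = 0.
Proof.
  intros HW. apply (derive_zero_at_min W 1); [apply HW|].
  intros s. rewrite (pot_1 _ _ _ HW). apply HW.
Qed.

Lemma derive_shift (x : R -> R) (t d k : R) :
  is_derive x (t + k) d -> is_derive (fun s => x (s + k)) t d.
Proof.
  intros H. rewrite <- (Rmult_1_l d). apply (is_derive_comp x (fun s => s + k)); auto.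
  auto_derive; auto.
Qed.

Lemma derive_reflect (x : R -> R) (t d : R) :
  is_derive x (- t) d -> is_derive (fun s => - x (- s)) t d.
Proof.
  intros H. replace d with (- (-1 * d)) by ring.
  apply (is_derive_opp (fun s => x (- s))).
  apply (is_derive_comp x (fun s => - s)); auto.
  auto_derive; auto.
Qed.

Lemma periodic_int (p : R -> R) (T : R) (z : Z) :
  (forall t, p (t + T) = p t) -> forall t, p (t + IZR z * T) = p t.
Proof.
  intros HT. induction z as [|z IH|z IH] using Z.peano_ind; intros t.
  - f_equal. ring.
  - rewrite succ_IZR, <- (IH t), <- (HT (t + IZR z * T)). f_equal. ring.
  - rewrite <- Z.sub_1_r, minus_IZR, <- (IH t), <- (HT (t + (IZR z - 1) * T)). f_equal. ring.
Qed.

Lemma periodic_shift (p : R -> R) (T t0 : R) :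
  0 < T -> (forall t, p (t + T) = p t) ->
  exists k, 0 <= t0 - k <= T /\ forall t, p (t + k) = p t.
Proof.
  intros HT Hp.
  (* [up r] lies in [(r, r + 1]], so [up r - 1] is the integer part of [r]. *)
  exists (IZR (up (t0 / T) - 1) * T). split.
  - rewrite minus_IZR. destruct (archimed (t0 / T)) as [H1 H2].
    assert (E : t0 = t0 / T * T) by (field; lra). rewrite E at 1 3.
    nra.
  - now apply periodic_int.
Qed.

Lemma path_shift (x dx : R -> R) (K k : R) : path x dx K ->
  path (fun t => x (t + k)) (fun t => dx (t + k)) (K + Rabs k).
Proof.
  intros H. pose proof (path_dcont _ _ _ H).
  assert (- Rabs k <= k <= Rabs k) by (apply Rabs_le_between; lra).
  split.
  - intros t. apply derive_shift, H.
  - ct.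
  - intros. apply H. lra.
  - intros. apply H. lra.
Qed.

(** A strict inequality between coefficients need not survive the infimum; here it does because the
    saving [gain] does not depend on the path. It is the product of a lower bound [kappa] for
    [bP - b] on a fixed compact set, the minimum of [W] near 0, and a time [tau] during which every
    near-minimizer stays near 0. *)
Lemma min_level_lt (W w b bP : R -> R) (L b0 B T m mP : R) :
  potential W w L -> coefficient b b0 B -> coefficient bP b0 B ->
  (forall t, b t < bP t) -> 0 < T -> (forall t, bP (t + T) = bP t) ->
  min_level W b m -> min_level W bP mP -> m < mP.
Proof.
  intros HW Hb HbP Hlt HT Hper [Hm _] [_ HmP].
  set (M := mP + 1).
  assert (HM : 0 < M).
  { destruct (HmP 1 ltac:(lra)) as (x & dx & K & Hx & Hx1).
    pose proof (action_nonneg _ _ _ _ _ _ _ _ _ HW HbP Hx). unfold M. lra. }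
  pose proof (coef_cont _ _ _ Hb) as Hbc. pose proof (coef_cont _ _ _ HbP) as HbPc.
  pose proof (pot_cont _ _ _ HW) as HWc.
  destruct (cont_min (fun t => bP t - b t) 0 (T + 1)) as (s1 & _ & Hs1); [lra|ct|].
  set (kappa := bP s1 - b s1) in *.
  assert (Hk : 0 < kappa) by (unfold kappa; specialize (Hlt s1); lra).
  destruct (cont_min W (- / 2) (/ 2)) as (s2 & Hs2r & Hs2); [lra|ct|].
  assert (Hv : 0 < W s2) by (apply (pot_pos _ _ _ HW); lra).
  (* After a crossing of 0 the Hoelder bound gives [y ^ 2 <= 2 * M * tau <= / 4], which keeps [y] in
     [[- / 2, / 2]]. Also [tau <= 1], so a window starting in [[0, T]] stays in [[0, T + 1]]. *)
  set (tau := / (8 * (M + 1))).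
  assert (Htau : 0 < tau) by (apply Rinv_0_lt_compat; lra).
  assert (HtauM : tau * (8 * (M + 1)) = 1) by (unfold tau; field; lra).
  assert (Htau1 : tau <= 1) by nra.
  set (gain := kappa * W s2 * (tau)).
  assert (Hgain : 0 < gain) by (unfold gain; repeat apply Rmult_lt_0_compat; lra).
  (* The 1 keeps the action below [M]; [gain] makes the excess over [mP] smaller than the saving. *)
  destruct (HmP (Rmin 1 gain)) as (x & dx & K & Hx & Hxa); [now apply Rmin_glb_lt; lra|].
  pose proof (Rmin_l 1 gain). pose proof (Rmin_r 1 gain).
  assert (HK : 0 < K) by exact (path_pos _ _ _ Hx).
  destruct (cont_ivt x (- K) K 0) as (t0 & _ & Ht0); [lra|eapply path_cont; eauto| |].
  { rewrite (path_left _ _ _ Hx) by lra. rewrite (path_right _ _ _ Hx) by lra. lra. }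
  destruct (periodic_shift bP T t0 HT Hper) as (k & Hk0 & Hkp).
  pose proof (path_shift x dx K k Hx) as Hy.
  set (y := fun t => x (t + k)) in *. set (dy := fun t => dx (t + k)) in *.
  set (t1 := t0 - k) in *.
  assert (Hy0 : y t1 = 0) by (unfold y, t1; rewrite <- Ht0; f_equal; ring).
  apply (path_widen _ _ _ (K + Rabs k + T + 1)) in Hy; [|lra].
  pose proof (Rabs_pos k).
  set (K' := K + Rabs k + T + 1) in *.
  assert (Hya : action W bP y dy (- K') K' <= action W bP x dx (- K) K).
  { replace (action W bP y dy (- K') K') with (action W bP x dx (- K' + k) (K' + k)).
    - apply (action_sub W w bP x dx L b0 B); auto. unfold K'; lra.
    - unfold action. rewrite <- int_shift by (eapply path_lagrangian_cont; eauto).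
      apply int_ext; [unfold K'; lra|]. intros t _. unfold lagrangian, y, dy.
      now rewrite Hkp. }
  assert (Hyc : cont y) by (eapply path_cont; eauto).
  assert (Hdyc : cont dy) by apply Hy.
  assert (Hsplit : action W b y dy (- K') K' =
    action W bP y dy (- K') K' - int (fun t => (bP t - b t) * W (y t)) (- K') K').
  { unfold action. rewrite <- int_minus.
    - apply int_ext; [unfold K'; lra|]. intros t _. unfold lagrangian. ring.
    - now apply lagrangian_cont.
    - ct. }
  assert (Hg : gain <= int (fun t => (bP t - b t) * W (y t)) (- K') K').
  { apply Rle_trans with (int (fun t => (bP t - b t) * W (y t)) t1 (t1 + tau)).
    - replace gain with (kappa * W s2 * (t1 + tau - t1)) by (unfold gain; ring).
      apply int_ge_const; [lra|ct|].
      intros t Ht.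
      assert (Hyt : - / 2 <= y t <= / 2).
      { assert (HaM : action W bP y dy (- K') K' <= M) by (unfold M; lra).
        pose proof (action_holder W w bP y dy L b0 B K' M t t1 HW HbP Hy HaM) as Hh.
        rewrite Hy0, Rminus_0_r, Rabs_pos_eq in Hh by lra.
        assert (y t ^ 2 <= / 4) by nra. split; nra. }
      specialize (Hs1 t ltac:(lra)). specialize (Hs2 (y t) Hyt). cbv beta in Hs1.
      apply Rmult_le_compat; lra.
    - apply int_subinterval; try (unfold K'; lra).
      + ct.
      + intros t. specialize (Hlt t). pose proof (pot_nonneg _ _ _ HW (y t)).
        apply Rmult_le_pos; lra. }
  specialize (Hm y dy K' Hy). lra.
Qed.

(* Cutting the path off at [-1] to the left of a window [R, R + 1] on which it is close
   to [-1] costs little, and to the right of the window [bP] and [b] nearly agree. *)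
Lemma cutoff_estimate (W w b bP x dx : R -> R) (L b0 B mP K R0 delta theta : R) :
  potential W w L -> coefficient b b0 B -> coefficient bP b0 B ->
  (forall y dy K', path y dy K' -> mP <= action W bP y dy (- K') K') ->
  path x dx K -> 0 < theta ->
  (forall t, R0 <= t -> bP t <= (1 + theta) * b t) ->
  (forall t, R0 <= t <= R0 + 1 -> Rabs (x t + 1) <= delta) ->
  mP <= (1 + theta) * action W b x dx (- K) K
        + (2 * (1 + / theta) + B * L) * delta ^ 2.
Proof.
  intros HW Hb HbP HmP Hx Hth HR0 Hdel.
  set (z := fun t => -1 + step (t - R0) * (x t + 1)).
  set (dz := fun t => dstep (t - R0) * (x t + 1) + step (t - R0) * dx t).
  set (K' := Rmax K (Rmax (- R0) (R0 + 1))).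
  assert (K <= K' /\ - R0 <= K' /\ R0 + 1 <= K') as (HK1 & HK2 & HK3).
  { unfold K'. pose proof (Rmax_l K (Rmax (- R0) (R0 + 1))).
    pose proof (Rmax_r K (Rmax (- R0) (R0 + 1))).
    pose proof (Rmax_l (- R0) (R0 + 1)). pose proof (Rmax_r (- R0) (R0 + 1)). lra. }
  pose proof (path_cont _ _ _ Hx) as Hxc. pose proof (path_dcont _ _ _ Hx) as Hdxc.
  pose proof cont_step as Hs. pose proof cont_dstep as Hds.
  assert (Hz : path z dz K').
  { split.
    - intros t. unfold z, dz.
      assert (H1 : is_derive (fun t => step (t - R0)) t (dstep (t - R0))).
      { apply (derive_shift step t (dstep (t - R0)) (- R0)). apply step_derive. }
      pose proof (path_derive _ _ _ Hx t) as H2.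
      apply is_derive_Reals. apply is_derive_Reals in H1, H2.
      replace (dstep (t - R0) * (x t + 1) + step (t - R0) * dx t)
        with (0 + (dstep (t - R0) * (x t + 1) + step (t - R0) * (dx t + 0))) by ring.
      apply (derivable_pt_lim_plus (fun _ => -1)); [apply derivable_pt_lim_const|].
      apply (derivable_pt_lim_mult (fun t => step (t - R0)) (fun t => x t + 1)); auto.
      apply (derivable_pt_lim_plus x (fun _ => 1)); auto. apply derivable_pt_lim_const.
    - unfold dz. ct.
    - intros t Ht. unfold z.
      destruct (Rle_dec t (- K)).
      + rewrite (path_left _ _ _ Hx) by lra. ring.
      + rewrite step_low by lra. ring.
    - intros t Ht. unfold z. rewrite step_high, (path_right _ _ _ Hx) by lra. ring. }
  eapply Rle_trans; [exact (HmP z dz K' Hz)|].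
  rewrite <- (action_widen W w b x dx L b0 B K K') by assumption.
  set (E := (2 * (1 + / theta) + B * L) * delta ^ 2).
  assert (Hl : forall t, 0 <= lagrangian W b x dx t)
    by (intros; eapply lagrangian_nonneg; eauto).
  assert (Hlc : cont (lagrangian W b x dx)) by (eapply path_lagrangian_cont; eauto).
  assert (Hlzc : cont (lagrangian W bP z dz)) by (eapply path_lagrangian_cont; eauto).
  assert (A1 : int (lagrangian W bP z dz) (- K') R0 <= (1 + theta) * int (lagrangian W b x dx) (- K') R0).
  { rewrite <- int_scal by assumption. apply int_le; [lra|ct|ct|].
    intros t Ht. replace (lagrangian W bP z dz t) with 0.
    - specialize (Hl t). nra.
    - unfold lagrangian, z, dz, dstep. rewrite step_low, clip_low by lra.
      replace (-1 + 0 * (x t + 1)) with (-1) by ring. rewrite (pot_m1 _ _ _ HW). field. }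
  assert (A3 : int (lagrangian W bP z dz) (R0 + 1) K' <= (1 + theta) * int (lagrangian W b x dx) (R0 + 1) K').
  { rewrite <- int_scal by assumption. apply int_le; [lra|ct|ct|].
    intros t Ht. unfold lagrangian, z, dz, dstep. rewrite step_high, clip_high by lra.
    replace (-1 + 1 * (x t + 1)) with (x t) by ring.
    replace (6 * (1 * (1 - 1)) * (x t + 1) + 1 * dx t) with (dx t) by ring.
    specialize (HR0 t ltac:(lra)). pose proof (pot_nonneg _ _ _ HW (x t)).
    pose proof (pow2_ge_0 (dx t)). nra. }
  (* The window has length 1, so a pointwise excess [E] integrates to [E]. *)
  assert (A2 : int (lagrangian W bP z dz) R0 (R0 + 1) <= (1 + theta) * int (lagrangian W b x dx) R0 (R0 + 1) + E).
  { replace E with (E * (R0 + 1 - R0)) by ring. rewrite <- int_const.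
    rewrite <- int_scal, <- int_plus by ct. apply int_le; [lra|ct|ct|].
    intros t Ht. unfold lagrangian.
    specialize (Hdel t ltac:(lra)).
    pose proof (step_bounds (t - R0)) as Hst. pose proof (dstep_bounds (t - R0)) as Hdst.
    assert (Hx2 : (x t + 1) ^ 2 <= delta ^ 2).
    { rewrite <- (pow2_abs (x t + 1)). apply pow_incr. split; [apply Rabs_pos|exact Hdel]. }
    (* [W] and [w] both vanish at -1, so [W] is quadratically small at distance [delta] from that
       well. *)
    assert (B1 : bP t * W (z t) <= B * L * delta ^ 2).
    { pose proof (pot_quadratic W w L (-1) (z t) HW) as Hq.
      rewrite (pot_m1 _ _ _ HW), (pot_dm1 _ _ _ HW) in Hq.
      apply Rabs_le_between in Hq. destruct Hq as [_ Hq].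
      assert (Hzz : (z t - -1) ^ 2 <= delta ^ 2).
      { unfold z. replace (-1 + step (t - R0) * (x t + 1) - -1)
          with (step (t - R0) * (x t + 1)) by ring. rewrite Rpow_mult_distr.
        pose proof (pow2_ge_0 (x t + 1)). assert (step (t - R0) ^ 2 <= 1) by nra. nra. }
      pose proof (pot_L_nonneg _ _ _ HW) as HL.
      assert (W (z t) <= L * delta ^ 2) by nra.
      pose proof (coef_bounds _ _ _ HbP t). pose proof (coef_pos _ _ _ HbP).
      pose proof (pot_nonneg _ _ _ HW (z t)).
      rewrite Rmult_assoc. apply Rmult_le_compat; lra. }
    (* Young's inequality for [dz = p + q] puts the factor [1 + theta] on the part of [x'], matching
       the factor lost between [bP] and [b]. The rest is [(1 + / theta) * q ^ 2 / 2] with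
       [q ^ 2 <= 4 * delta ^ 2], as [dstep <= 2]. *)
    assert (B2 : dz t ^ 2 / 2 <= (1 + theta) * (dx t ^ 2 / 2) + 2 * (1 + / theta) * delta ^ 2).
    { set (p := step (t - R0) * dx t). set (q := dstep (t - R0) * (x t + 1)).
      assert (Hp : p ^ 2 <= dx t ^ 2).
      { unfold p. rewrite Rpow_mult_distr. pose proof (pow2_ge_0 (dx t)).
        assert (step (t - R0) ^ 2 <= 1) by nra. nra. }
      assert (Hq : q ^ 2 <= 4 * delta ^ 2).
      { unfold q. rewrite Rpow_mult_distr. pose proof (pow2_ge_0 (x t + 1)).
        assert (dstep (t - R0) ^ 2 <= 4) by nra. nra. }
      assert (Hi : 0 < / theta) by now apply Rinv_0_lt_compat.
      assert (Hyoung : 2 * p * q <= theta * p ^ 2 + / theta * q ^ 2).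
      { pose proof (pow2_ge_0 (theta * p - q)) as Hsq.
        assert (Hsq' : 0 <= / theta * (theta * p - q) ^ 2) by nra.
        replace (/ theta * (theta * p - q) ^ 2)
          with (theta * p ^ 2 - 2 * p * q + / theta * q ^ 2) in Hsq' by (field; lra).
        lra. }
      replace (dz t) with (p + q) by (unfold dz, p, q; ring).
      assert (theta * p ^ 2 <= theta * dx t ^ 2) by nra.
      assert (/ theta * q ^ 2 <= / theta * (4 * delta ^ 2)) by nra.
      nra. }
    assert (0 <= (1 + theta) * (b t * W (x t))).
    { pose proof (pot_nonneg _ _ _ HW (x t)). pose proof (coef_bounds _ _ _ Hb t).
      pose proof (coef_pos _ _ _ Hb). apply Rmult_le_pos; [lra|]. apply Rmult_le_pos; lra. }
    unfold E. lra. }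
  unfold action.
  rewrite <- (int_chasles (lagrangian W bP z dz) (- K') R0 K') by assumption.
  rewrite <- (int_chasles (lagrangian W bP z dz) R0 (R0 + 1) K') by assumption.
  rewrite <- (int_chasles (lagrangian W b x dx) (- K') R0 K') by assumption.
  rewrite <- (int_chasles (lagrangian W b x dx) R0 (R0 + 1) K') by assumption.
  lra.
Qed.

(** [g] is a cluster point of the sequence for locally uniform convergence, in the form delivered by
    [ascoli]. *)
Definition cluster (f : nat -> R -> R) (g : R -> R) : Prop :=
  forall N e n0, 0 < e ->
  exists n, (n0 <= n)%nat /\ forall t, Rabs t <= N -> Rabs (f n t - g t) <= e.

Lemma cluster_not_m1_right (W w b bP g : R -> R) (f df : nat -> R -> R) (K : nat -> R)
    (L b0 B m mP : R) :
  potential W w L -> coefficient b b0 B -> coefficient bP b0 B ->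
  (forall e, 0 < e -> exists R0, forall t, R0 <= t -> bP t <= b t + e) ->
  (forall y dy K', path y dy K' -> mP <= action W bP y dy (- K') K') ->
  0 <= m < mP ->
  (forall n, path (f n) (df n) (K n)) ->
  (forall n, action W b (f n) (df n) (- K n) (K n) <= m + / (INR n + 1)) ->
  cluster f g ->
  ~ (forall e, 0 < e -> exists R0, forall t, R0 <= t -> Rabs (g t + 1) <= e).
Proof.
  intros HW Hb HbP Hlim HmP Hm Hf Ha Hcl Hg.
  set (gap := mP - m). assert (Hgap : 0 < gap) by (unfold gap; lra).
  (* Budget for the contradiction: [gap / 4] for the factor [theta] on an action of at most [m + 1],
     [gap / 8] for the cutoff, and less than [gap / 4] for the excess of the n-th path over [m]. *)
  set (theta := gap / (4 * (m + 1))).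
  assert (Hth : 0 < theta) by (apply Rdiv_lt_0_compat; lra).
  assert (Hthm : theta * (m + 1) = gap / 4) by (unfold theta; field; lra).
  assert (Hi : 0 < / theta) by now apply Rinv_0_lt_compat.
  pose proof (coef_pos _ _ _ Hb) as Hb0. pose proof (coef_bounds _ _ _ Hb) as Hbb.
  pose proof (pot_L_nonneg _ _ _ HW) as HL.
  set (C := 2 * (1 + / theta) + B * L).
  assert (HC : 2 <= C).
  { unfold C. specialize (Hbb 0). assert (0 <= B * L) by (apply Rmult_le_pos; lra). lra. }
  set (delta := Rmin 1 (gap / (8 * C))).
  assert (Hd : 0 < delta).
  { apply Rmin_glb_lt; [lra|]. apply Rdiv_lt_0_compat; lra. }
  assert (HCd : C * delta ^ 2 <= gap / 8).
  { assert (H1 : delta <= 1) by apply Rmin_l.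
    assert (H2 : delta <= gap / (8 * C)) by apply Rmin_r.
    assert (H3 : C * (gap / (8 * C)) = gap / 8) by (field; lra).
    assert (C * delta <= gap / 8) by nra. nra. }
  (* Since [b0 <= b t], an additive error [theta * b0] is a relative error [theta]. *)
  destruct (Hlim (theta * b0)) as [R1 HR1]; [nra|].
  destruct (Hg (delta / 2)) as [R2 HR2]; [lra|].
  set (R0 := Rmax R1 R2).
  pose proof (Rmax_l R1 R2 : R1 <= R0). pose proof (Rmax_r R1 R2 : R2 <= R0).
  destruct (archimedean_inv (Rmin 1 (gap / 4))) as [n0 Hn0]; [apply Rmin_glb_lt; lra|].
  destruct (Hcl (Rabs R0 + 1) (delta / 2) n0) as (n & Hn & Hfg); [lra|].
  specialize (Hn0 n Hn).
  pose proof (Rmin_l 1 (gap / 4)). pose proof (Rmin_r 1 (gap / 4)).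
  assert (Hest := cutoff_estimate W w b bP (f n) (df n) L b0 B mP (K n) R0 delta theta
    HW Hb HbP HmP (Hf n) Hth).
  fold C in Hest.
  assert (Hfin : mP <= (1 + theta) * action W b (f n) (df n) (- K n) (K n) + C * delta ^ 2).
  { apply Hest.
    - intros t Ht. specialize (HR1 t ltac:(lra)). specialize (Hbb t). nra.
    - intros t Ht. specialize (HR2 t ltac:(lra)).
      specialize (Hfg t). assert (Rabs t <= Rabs R0 + 1) as Habs.
      { unfold Rabs. repeat destruct Rcase_abs; lra. }
      specialize (Hfg Habs). apply Rabs_le_between in HR2, Hfg. apply Rabs_le. lra. }
  specialize (Ha n).
  assert ((1 + theta) * action W b (f n) (df n) (- K n) (K n)
    <= (1 + theta) * (m + / (INR n + 1))) by (apply Rmult_le_compat_l; lra).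
  assert (theta * (m + / (INR n + 1)) <= theta * (m + 1)) by (apply Rmult_le_compat_l; lra).
  unfold gap in *. lra.
Qed.

(** * Symmetry under reversal of time and exchange of the wells *)

Lemma potential_reflect (W w : R -> R) (L : R) : potential W w L ->
  potential (fun x => W (- x)) (fun x => - w (- x)) L.
Proof.
  intros H. split.
  - intros x. replace (- w (- x)) with (-1 * w (- x)) by ring.
    apply (is_derive_comp W (fun s => - s)); [apply H|]. auto_derive; auto.
  - intros x y. replace (- w (- x) - - w (- y)) with (- (w (- x) - w (- y))) by ring.
    rewrite Rabs_Ropp. eapply Rle_trans; [apply H|].
    replace (- x - - y) with (- (x - y)) by ring. rewrite Rabs_Ropp. lra.
  - intros x. apply H.
  - replace (- -1) with 1 by ring. apply H.
  - apply H.
  - intros x H1 H2. apply H; lra.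
  - intros x. rewrite <- (Rabs_Ropp x). apply H.
Qed.

Lemma coefficient_reflect (b : R -> R) (b0 B : R) : coefficient b b0 B ->
  coefficient (fun t => b (- t)) b0 B.
Proof.
  intros [H1 H2 H3]. split; auto. ct.
Qed.

Lemma path_reflect (x dx : R -> R) (K : R) : path x dx K ->
  path (fun t => - x (- t)) (fun t => dx (- t)) K.
Proof.
  intros H. pose proof (path_dcont _ _ _ H). split.
  - intros t. apply derive_reflect, H.
  - ct.
  - intros t Ht. rewrite (path_right _ _ _ H) by lra. reflexivity.
  - intros t Ht. rewrite (path_left _ _ _ H) by lra. ring.
Qed.

Lemma action_reflect (W b x dx : R -> R) (K : R) :
  cont W -> cont b -> path x dx K ->
  action (fun y => W (- y)) (fun t => b (- t)) x dx (- K) K =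
  action W b (fun t => - x (- t)) (fun t => dx (- t)) (- K) K.
Proof.
  intros HW Hb Hx. pose proof (path_cont _ _ _ Hx). pose proof (path_dcont _ _ _ Hx).
  pose proof (path_pos _ _ _ Hx).
  unfold action.
  rewrite <- (Ropp_involutive K) at 4. rewrite <- int_reflect.
  - apply int_ext; [lra|]. intros t _. unfold lagrangian. now rewrite Ropp_involutive.
  - apply lagrangian_cont; ct.
Qed.

(** The map taking [x(t)] to [- x(- t)] sends paths to paths and preserves the action once [W] and
    [b] are reflected. It turns a limit 1 at the left end into a limit -1 at the right end. *)
Lemma cluster_not_1_left (W w b bP g : R -> R) (f df : nat -> R -> R) (K : nat -> R)
    (L b0 B m mP : R) :
  potential W w L -> coefficient b b0 B -> coefficient bP b0 B ->
  (forall e, 0 < e -> exists R0, forall t, t <= R0 -> bP t <= b t + e) ->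
  (forall y dy K', path y dy K' -> mP <= action W bP y dy (- K') K') ->
  0 <= m < mP ->
  (forall n, path (f n) (df n) (K n)) ->
  (forall n, action W b (f n) (df n) (- K n) (K n) <= m + / (INR n + 1)) ->
  cluster f g ->
  ~ (forall e, 0 < e -> exists R0, forall t, t <= R0 -> Rabs (g t - 1) <= e).
Proof.
  intros HW Hb HbP Hlim HmP Hm Hf Ha Hcl Hg.
  pose proof (pot_cont _ _ _ HW) as HWc.
  apply (cluster_not_m1_right (fun x => W (- x)) (fun x => - w (- x)) (fun t => b (- t))
    (fun t => bP (- t)) (fun t => - g (- t)) (fun n t => - f n (- t))
    (fun n t => df n (- t)) K L b0 B m mP); auto using potential_reflect, coefficient_reflect,
    path_reflect.
  - intros e He. destruct (Hlim e He) as [R0 HR0]. exists (- R0).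
    intros t Ht. apply HR0. lra.
  - intros y dy K' Hy. rewrite action_reflect; [|exact HWc|apply HbP|exact Hy].
    apply HmP. now apply path_reflect.
  - intros n. rewrite action_reflect; [|exact HWc|apply Hb|now apply path_reflect].
    eapply Rle_trans; [|exact (Ha n)]. apply Req_le. unfold action. apply int_ext.
    + pose proof (path_pos _ _ _ (Hf n)). lra.
    + intros t _. unfold lagrangian. now rewrite !Ropp_involutive.
  - intros N e n0 He. destruct (Hcl N e n0 He) as (n & Hn & H).
    exists n. split; auto. intros t Ht.
    replace (- f n (- t) - - g (- t)) with (- (f n (- t) - g (- t))) by ring.
    rewrite Rabs_Ropp. apply H. now rewrite Rabs_Ropp.
  - intros e He. destruct (Hg e He) as [R0 HR0]. exists (- R0). intros t Ht.
    replace (- g (- t) + 1) with (- (g (- t) - 1)) by ring. rewrite Rabs_Ropp.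
    apply HR0. lra.
Qed.

(** * The approximate Euler-Lagrange equation *)

Lemma int_zero (f : R -> R) (u v : R) : u <= v ->
  (forall t, u < t < v -> f t = 0) -> int f u v = 0.
Proof.
  intros Huv H. rewrite (int_ext f (fun _ => 0)) by assumption.
  rewrite int_const. ring.
Qed.

Lemma int_support (f : R -> R) (u u' v' v : R) : cont f -> u <= u' -> v' <= v ->
  (forall t, t <= u' -> f t = 0) -> (forall t, v' <= t -> f t = 0) ->
  int f u v = int f u' v'.
Proof.
  intros Hf Hu Hv H1 H2.
  rewrite <- (int_chasles f u u' v), <- (int_chasles f u' v' v) by assumption.
  rewrite (int_zero f u u'), (int_zero f v' v); auto; try ring; intros; [apply H2|apply H1]; lra.
Qed.

Lemma path_perturb (x dx phi dphi : R -> R) (K s : R) :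
  path x dx K -> (forall t, is_derive phi t (dphi t)) -> cont dphi ->
  (forall t, t <= - K -> phi t = 0) -> (forall t, K <= t -> phi t = 0) ->
  path (fun t => x t - s * phi t) (fun t => dx t - s * dphi t) K.
Proof.
  intros Hx Hphi Hc H1 H2. pose proof (path_dcont _ _ _ Hx). split.
  - intros t. pose proof (path_derive _ _ _ Hx t) as Hd. specialize (Hphi t).
    apply is_derive_Reals. apply is_derive_Reals in Hd, Hphi.
    apply (derivable_pt_lim_minus x (fun t => s * phi t)); auto.
    now apply (derivable_pt_lim_scal phi).
  - ct.
  - intros t Ht. rewrite H1, (path_left _ _ _ Hx) by assumption. ring.
  - intros t Ht. rewrite H2, (path_right _ _ _ Hx) by assumption. ring.
Qed.

(** For a solution of the equation this is [x'] up to an additive constant. *)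
Definition force (w b x : R -> R) (t : R) : R := int (fun s => b s * w (x s)) 0 t.

(* The test function [phi] has [phi' = psi h], with [psi] a cutoff and
   [h = x' - force - c], where [c] makes [phi] compactly supported. With this choice the
   first variation is exactly [int psi h^2], and it controls the second-order term, so
   near-minimality of [x] makes [h] small in L^2. *)
Lemma almost_euler_lagrange (W w b x dx : R -> R) (L b0 B K m nu N : R) :
  potential W w L -> coefficient b b0 B -> path x dx K ->
  (forall y dy K', path y dy K' -> m <= action W b y dy (- K') K') ->
  action W b x dx (- K) K <= m + nu -> 0 < N ->
  exists c, forall t, Rabs t <= N ->
    (x t - x 0 - int (force w b x) 0 t - c * t) ^ 2
      <= N * (4 * (/ 2 + B * L * (2 * (N + 1)) ^ 2) * nu).
Proof.
  intros HW Hb Hx Hm Ha HN.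
  pose proof (pot_cont _ _ _ HW) as HWc. pose proof (pot_dcont _ _ _ HW) as Hwc.
  pose proof (coef_cont _ _ _ Hb) as Hbc. pose proof (pot_L_nonneg _ _ _ HW) as HL.
  pose proof (path_cont _ _ _ Hx) as Hxc. pose proof (path_dcont _ _ _ Hx) as Hdxc.
  pose proof (coef_pos _ _ _ Hb) as Hb0. pose proof (coef_bounds _ _ _ Hb) as Hbb.
  assert (HB : 0 < B) by (specialize (Hbb 0); lra).
  set (N1 := N + 1). set (G := force w b x).
  assert (HGd : forall t, is_derive G t (b t * w (x t))).
  { intros t. apply (derive_int (fun s => b s * w (x s))). ct. }
  assert (HGc : cont G) by (now apply cont_derive with (fun t => b t * w (x t))).
  set (psi := fun t => clip 0 1 (N1 - Rabs t)).
  assert (Hpsic : cont psi) by (pose proof (cont_clip 0 1); unfold psi; ct).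
  assert (Hpsi01 : forall t, 0 <= psi t <= 1) by (intros; apply clip_bounds; lra).
  assert (Hpsi1 : forall t, Rabs t <= N -> psi t = 1).
  { intros t Ht. apply clip_high; unfold N1; lra. }
  assert (Hpsi0 : forall t, N1 <= Rabs t -> psi t = 0).
  { intros t Ht. apply clip_low; lra. }
  assert (Hpsipos : 0 < int psi (- N1) N1).
  { apply Rlt_le_trans with (1 * (N - - N)); [lra|].
    eapply Rle_trans; [|apply (int_subinterval psi (- N1) (- N) N N1); unfold N1; auto; try lra].
    - apply int_ge_const; auto; [lra|]. intros t Ht. rewrite Hpsi1; [lra|].
      apply Rabs_le; lra.
    - apply Hpsi01. }
  (* The mean of [dx - G] weighted by [psi]: exactly what makes [dphi] have integral zero, so that
     [phi] vanishes again to the right of [N1]. *)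
  set (c := int (fun t => psi t * (dx t - G t)) (- N1) N1 / int psi (- N1) N1).
  set (h := fun t => dx t - G t - c).
  assert (Hhc : cont h) by (unfold h; ct).
  set (dphi := fun t => psi t * h t).
  assert (Hdphic : cont dphi) by (unfold dphi; ct).
  set (phi := fun t => int dphi (- N1) t).
  assert (Hphid : forall t, is_derive phi t (dphi t)) by (intros; now apply derive_int).
  assert (Hphic : cont phi) by (now apply cont_derive with dphi).
  assert (Hphil : forall t, t <= - N1 -> phi t = 0).
  { intros t Ht. unfold phi. pose proof (int_chasles dphi (- N1) t (- N1) Hdphic) as E.
    rewrite int_point, (int_zero dphi t (- N1)) in E; [lra|lra|].
    intros s Hs. unfold dphi. rewrite Hpsi0; [ring|]. rewrite Rabs_left1; unfold N1 in *; lra. }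
  assert (HphiN : phi N1 = 0).
  { unfold phi. rewrite (int_ext dphi (fun t => psi t * (dx t - G t) - c * psi t)).
    - rewrite int_minus, int_scal by ct. unfold c. field. lra.
    - unfold N1; lra.
    - intros t _. unfold dphi, h. ring. }
  assert (Hphir : forall t, N1 <= t -> phi t = 0).
  { intros t Ht. unfold phi. rewrite <- (int_chasles dphi (- N1) N1 t) by assumption.
    fold (phi N1). rewrite HphiN, (int_zero dphi N1 t); [ring|lra|].
    intros s Hs. unfold dphi. rewrite Hpsi0; [ring|].
    rewrite Rabs_pos_eq; unfold N1 in *; lra. }
  set (K' := Rmax K N1).
  pose proof (Rmax_l K N1 : K <= K') as HK1. pose proof (Rmax_r K N1 : N1 <= K') as HK2.
  assert (HN1 : 0 < N1) by (unfold N1; lra).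
  pose proof (path_widen _ _ _ _ HK1 Hx) as Hx'.
  rewrite <- (action_widen W w b x dx L b0 B K K') in Ha by assumption.
  set (S := int (fun t => psi t * h t ^ 2) (- K') K').
  assert (Hph2 : forall t, 0 <= psi t * h t ^ 2).
  { intros t. apply Rmult_le_pos; [apply Hpsi01|apply pow2_ge_0]. }
  assert (HS0 : 0 <= S) by (apply int_ge0; auto; [lra|ct]).
  (* Integration by parts moves the force onto [dphi], and [c * dphi] integrates to zero. What
     remains is [(dx - G - c) * dphi], that is [psi * h ^ 2]. *)
  assert (Hfirst : int (fun t => dx t * dphi t + b t * w (x t) * phi t) (- K') K' = S).
  { assert (E1 : int (fun t => b t * w (x t) * phi t + G t * dphi t) (- K') K' = 0).
    { rewrite (int_derive (fun t => G t * phi t)).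
      - rewrite Hphir, Hphil by lra. ring.
      - intros t. specialize (HGd t). specialize (Hphid t).
        apply is_derive_Reals. apply is_derive_Reals in HGd, Hphid.
        now apply (derivable_pt_lim_mult G phi).
      - ct. }
    assert (E2 : int (fun t => c * dphi t) (- K') K' = 0).
    { rewrite int_scal, (int_derive phi) by assumption.
      rewrite Hphir, Hphil by lra. ring. }
    replace S with (S + int (fun t => b t * w (x t) * phi t + G t * dphi t) (- K') K'
      + int (fun t => c * dphi t) (- K') K') by (rewrite E1, E2; ring).
    unfold S. rewrite <- !int_plus by ct. apply int_ext; [lra|].
    intros t _. unfold dphi, h. ring. }
  (* As [0 <= psi <= 1], [psi ^ 2 <= psi]: the second-order kinetic term is bounded by the same [S]
     as the first variation. *)
  assert (Hdphi2 : forall u v, - K' <= u -> u <= v -> v <= K' ->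
    int (fun t => dphi t ^ 2) u v <= S).
  { intros u v H1 H2 H3. eapply Rle_trans; [|apply (int_subinterval _ (- K') u v K'); auto; ct].
    apply int_le; [lra|ct|ct|]. intros t _. unfold dphi. rewrite Rpow_mult_distr.
    specialize (Hpsi01 t). pose proof (pow2_ge_0 (h t)).
    assert (psi t ^ 2 <= psi t) by nra. nra. }
  (* Poincare inequality on the support, an interval of length [2 * N1]: one factor comes from
     Cauchy-Schwarz, the other from integrating in [t]. *)
  assert (Hphi2 : int (fun t => phi t ^ 2) (- K') K' <= (2 * N1) ^ 2 * S).
  { rewrite (int_support (fun t => phi t ^ 2) (- K') (- N1) N1 K'); try lra; [|ct| |].
    - replace ((2 * N1) ^ 2 * S) with ((2 * N1 * S) * (N1 - - N1)) by ring.
      apply int_le_const; [lra|ct|]. intros t Ht. unfold phi.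
      eapply Rle_trans; [apply int_cauchy_schwarz; [lra|assumption]|].
      apply Rmult_le_compat; try lra.
      + apply int_ge0; [lra|ct|]. intros; apply pow2_ge_0.
      + apply Hdphi2; lra.
    - intros t Ht. rewrite Hphil by assumption. ring.
    - intros t Ht. rewrite Hphir by assumption. ring. }
  set (C := / 2 + B * L * (2 * N1) ^ 2).
  assert (HC : 0 < C).
  { unfold C. pose proof (pow2_ge_0 (2 * N1)).
    assert (0 <= B * L) by (apply Rmult_le_pos; lra). nra. }
  assert (HS : S <= 4 * C * nu).
  { set (s := / (2 * C)). assert (Hs : 0 < s) by (apply Rinv_0_lt_compat; lra).
    assert (Hsec : action W b (fun t => x t - s * phi t) (fun t => dx t - s * dphi t) (- K') K'
      <= action W b x dx (- K') K' - s * S + s ^ 2 * (C * S)).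
    { rewrite <- Hfirst at 1. unfold action.
      apply Rle_trans with (int (fun t => lagrangian W b x dx t
        - s * (dx t * dphi t + b t * w (x t) * phi t)
        + (s ^ 2 * / 2 * dphi t ^ 2 + s ^ 2 * (B * L) * phi t ^ 2)) (- K') K').
      - assert (cont (lagrangian W b x dx)) by now apply lagrangian_cont.
        apply int_le; [lra| |ct|].
        { apply lagrangian_cont; ct. }
        intros t _. unfold lagrangian.
        pose proof (pot_quadratic W w L (x t) (x t - s * phi t) HW) as Hq.
        apply Rabs_le_between in Hq. destruct Hq as [_ Hq].
        replace (x t - s * phi t - x t) with (- (s * phi t)) in Hq by ring.
        specialize (Hbb t).
        assert (Hq2 : b t * (W (x t - s * phi t) - W (x t) + s * (w (x t) * phi t))
          <= B * L * (s * phi t) ^ 2).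
        { apply Rle_trans with (b t * (L * (s * phi t) ^ 2)).
          - apply Rmult_le_compat_l; [lra|]. nra.
          - rewrite Rmult_assoc. apply Rmult_le_compat_r; [|lra].
            apply Rmult_le_pos; [lra|apply pow2_ge_0]. }
        nra.
      - assert (cont (lagrangian W b x dx)) by now apply lagrangian_cont.
        rewrite int_plus, int_minus, int_scal by ct.
        set (S1 := int (fun t => dx t * dphi t + b t * w (x t) * phi t) (- K') K').
        rewrite int_plus, int_scal, int_scal by ct.
        specialize (Hdphi2 (- K') K' ltac:(lra) ltac:(lra) ltac:(lra)).
        apply Rplus_le_compat_l.
        assert (0 < s ^ 2) by (apply pow_lt; lra).
        unfold C.
        assert (s ^ 2 * / 2 * int (fun t => dphi t ^ 2) (- K') K' <= s ^ 2 * / 2 * S)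
          by (apply Rmult_le_compat_l; lra).
        assert (s ^ 2 * (B * L) * int (fun t => phi t ^ 2) (- K') K'
          <= s ^ 2 * (B * L) * ((2 * N1) ^ 2 * S)).
        { apply Rmult_le_compat_l; [|lra]. apply Rmult_le_pos; [lra|].
          apply Rmult_le_pos; lra. }
        nra. }
    pose proof (path_perturb x dx phi dphi K' s Hx' Hphid Hdphic) as Hp.
    assert (Hp' := Hp ltac:(intros; apply Hphil; lra) ltac:(intros; apply Hphir; lra)).
    specialize (Hm _ _ _ Hp').
    assert (E : s * S - s ^ 2 * (C * S) = S / (4 * C)) by (unfold s; field; lra).
    assert (HSnu : S / (4 * C) <= nu) by lra.
    replace S with (4 * C * (S / (4 * C))) by (field; lra).
    apply Rmult_le_compat_l; lra. }
  exists c.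
  (* On [[- N, N]] the cutoff is 1, so [S] bounds the integral of [h ^ 2]. Only intervals with an
     endpoint at 0 occur, of length at most [N]. *)
  assert (Hint : forall u v, - N <= u -> u <= v -> v <= N -> v - u <= N ->
    int h u v ^ 2 <= N * (4 * C * nu)).
  { intros u v H1 H2 H3 H4.
    eapply Rle_trans; [apply int_cauchy_schwarz; [lra|assumption]|].
    apply Rmult_le_compat; try lra.
    - apply int_ge0; [lra|ct|]. intros; apply pow2_ge_0.
    - eapply Rle_trans; [|exact HS].
      rewrite (int_ext _ (fun t => psi t * h t ^ 2)); [|lra|].
      + unfold S. apply int_subinterval; auto; unfold N1 in *; try lra. ct.
      + intros t Ht. rewrite Hpsi1; [ring|]. apply Rabs_le; lra. }
  intros t Ht.
  assert (E : x t - x 0 - int G 0 t - c * t = int h 0 t).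
  { unfold h. rewrite int_minus, int_minus, int_const by ct.
    rewrite (int_derive x dx); [ring|apply Hx|assumption]. }
  fold N1. fold C. fold G. rewrite E.
  apply Rabs_le_between in Ht.
  destruct (Rle_dec 0 t).
  - apply Hint; lra.
  - pose proof (int_chasles h 0 t 0 Hhc) as E0. rewrite int_point in E0.
    replace (int h 0 t) with (- int h t 0) by lra.
    replace ((- int h t 0) ^ 2) with (int h t 0 ^ 2) by ring. apply Hint; lra.
Qed.

(** * The limit of a minimizing sequence *)

Definition uniformly_cont (g : R -> R) : Prop :=
  forall e, 0 < e -> exists r, 0 < r /\
    forall s t, Rabs (s - t) <= r -> Rabs (g s - g t) <= e.

Lemma uniformly_cont_cont (g : R -> R) : uniformly_cont g -> cont g.
Proof.
  intros Hg t. apply filterlim_locally. intros [e He].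
  destruct (Hg (e / 2) ltac:(lra)) as (r & Hr & H).
  exists (mkposreal r Hr). intros s Hs. change (Rabs (s - t) < r) in Hs.
  change (Rabs (g s - g t) < e). specialize (H s t ltac:(lra)). lra.
Qed.

Lemma cluster_uniformly_cont (f : nat -> R -> R) (g : R -> R) :
  (forall e, 0 < e -> exists r, 0 < r /\
     forall n s t, Rabs (s - t) <= r -> Rabs (f n s - f n t) <= e) ->
  cluster f g -> uniformly_cont g.
Proof.
  intros Heq Hcl e He. destruct (Heq (e / 3) ltac:(lra)) as (r & Hr & H).
  exists r. split; auto. intros s t Hst.
  destruct (Hcl (Rmax (Rabs s) (Rabs t)) (e / 3) 0%nat) as (n & _ & Hn); [lra|].
  pose proof (Hn s (Rmax_l _ _)) as H1. pose proof (Hn t (Rmax_r _ _)) as H2.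
  specialize (H n s t Hst). apply Rabs_le_between in H, H1, H2. apply Rabs_le. lra.
Qed.

Lemma force_close (w b x y : R -> R) (L B N e t : R) :
  cont w -> cont b -> cont x -> cont y -> 0 <= L ->
  (forall u v, Rabs (w u - w v) <= L * Rabs (u - v)) -> (forall s, 0 <= b s <= B) ->
  (forall s, Rabs s <= N -> Rabs (x s - y s) <= e) -> Rabs t <= N ->
  Rabs (force w b x t - force w b y t) <= B * L * e * N.
Proof.
  intros Hw Hb Hx Hy HL Hlip Hbb Hxy Ht. unfold force. rewrite <- int_minus by ct.
  assert (0 <= e).
  { pose proof (Hxy t Ht). pose proof (Rabs_pos (x t - y t)). lra. }
  assert (HB : 0 <= B) by (specialize (Hbb 0); lra).
  eapply Rle_trans; [apply (int_abs_le _ 0 t (B * L * e)); [ct|]|].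
  - intros s Hs. rewrite <- Rmult_minus_distr_l, Rabs_mult.
    specialize (Hbb s). rewrite (Rabs_pos_eq (b s)) by lra.
    rewrite Rmult_assoc. apply Rmult_le_compat; try lra; [apply Rabs_pos|].
    eapply Rle_trans; [apply Hlip|]. apply Rmult_le_compat_l; [lra|].
    apply Hxy. apply Rabs_le_between in Ht. revert Hs. unfold Rmin, Rmax.
    intros Hs. apply Rabs_le. destruct Rle_dec; lra.
  - rewrite Rminus_0_r. apply Rmult_le_compat_l; [|lra].
    apply Rmult_le_pos; [|lra]. apply Rmult_le_pos; lra.
Qed.

(** The twice integrated defect [D x] is continuous under locally uniform convergence, and [D (f n)]
    is nearly linear on compact sets. A pointwise limit of linear functions vanishing at 0 is
    linear, so [D g] is linear. *)
Lemma cluster_euler_lagrange (W w b g : R -> R) (f df : nat -> R -> R) (K : nat -> R)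
    (L b0 B m : R) :
  potential W w L -> coefficient b b0 B ->
  (forall y dy K', path y dy K' -> m <= action W b y dy (- K') K') ->
  (forall n, path (f n) (df n) (K n)) ->
  (forall n, action W b (f n) (df n) (- K n) (K n) <= m + / (INR n + 1)) ->
  cluster f g -> cont g ->
  exists c, forall t, g t = g 0 + c * t + int (force w b g) 0 t.
Proof.
  intros HW Hb Hm Hf Ha Hcl Hgc.
  pose proof (pot_dcont _ _ _ HW) as Hwc. pose proof (coef_cont _ _ _ Hb) as Hbc.
  pose proof (pot_L_nonneg _ _ _ HW) as HL. pose proof (coef_bounds _ _ _ Hb) as Hbb.
  pose proof (coef_pos _ _ _ Hb) as Hb0.
  assert (HB : 0 <= B) by (specialize (Hbb 0); lra).
  assert (Hfc : forall n, cont (f n)) by (intros n; eapply path_cont; eauto).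
  assert (HFc : forall x, cont x -> cont (force w b x)).
  { intros x Hx. apply cont_derive with (fun t => b t * w (x t)). intros t.
    apply (derive_int (fun s => b s * w (x s))). ct. }
  set (D := fun x t => x t - x 0 - int (force w b x) 0 t).
  assert (HD : forall N e x t, 0 <= N -> cont x ->
    (forall s, Rabs s <= N -> Rabs (x s - g s) <= e) -> Rabs t <= N ->
    Rabs (D x t - D g t) <= (2 + B * L * N * N) * e).
  { intros N e x t HN Hx Hxg Ht. unfold D.
    assert (He : 0 <= e).
    { pose proof (Hxg t Ht). pose proof (Rabs_pos (x t - g t)). lra. }
    assert (HI : Rabs (int (force w b x) 0 t - int (force w b g) 0 t) <= B * L * e * N * N).
    { pose proof (HFc x Hx). pose proof (HFc g Hgc).
      assert (0 <= B * L * e * N).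
      { apply Rmult_le_pos; [|lra]. apply Rmult_le_pos; [|lra]. apply Rmult_le_pos; lra. }
      rewrite <- int_minus by ct.
      eapply Rle_trans; [apply (int_abs_le _ 0 t (B * L * e * N)); [ct|]|].
      - intros s Hs. apply (force_close w b x g L B N e s); auto.
        + apply HW.
        + intros r. specialize (Hbb r). lra.
        + apply Rabs_le_between in Ht. revert Hs. unfold Rmin, Rmax.
          intros Hs. apply Rabs_le. destruct Rle_dec; lra.
      - rewrite Rminus_0_r. now apply Rmult_le_compat_l. }
    pose proof (Hxg t Ht) as H1. pose proof (Hxg 0 ltac:(rewrite Rabs_R0; lra)) as H2.
    apply Rabs_le_between in HI, H1, H2. apply Rabs_le. lra. }
  (* The slopes attached to the paths [f n] are not known to converge. They are eliminated by
     comparing the values at [t] and at 1, which recovers the slope of [D g] as [D g 1]; hence also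
     [N := Rabs t + 1], so that both points are covered. *)
  exists (D g 1). intros t.
  assert (Hz : Rabs (D g t - t * D g 1) <= 0).
  { apply Rle_plus_epsilon. intros eta Heta. rewrite Rplus_0_l.
    set (N := Rabs t + 1). pose proof (Rabs_pos t) as Ht0.
    set (A := (3 + B * L * N * N) * (1 + Rabs t)).
    assert (0 <= B * L * N * N).
    { unfold N. repeat (apply Rmult_le_pos; try lra). }
    assert (HA : 0 < A) by (unfold A; nra).
    set (e := eta / A).
    assert (He : 0 < e) by (now apply Rdiv_lt_0_compat).
    set (M := N * (4 * (/ 2 + B * L * (2 * (N + 1)) ^ 2))).
    assert (HM : 0 < M).
    { unfold M. pose proof (pow2_ge_0 (2 * (N + 1))).
      assert (0 <= B * L) by (apply Rmult_le_pos; lra).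
      apply Rmult_lt_0_compat; [unfold N; lra|]. nra. }
    assert (He2 : 0 < e ^ 2 / M).
    { apply Rdiv_lt_0_compat; auto. apply pow_lt; auto. }
    destruct (archimedean_inv (e ^ 2 / M) He2) as [n0 Hn0].
    destruct (Hcl N e n0 He) as (n & Hn & Hfg). specialize (Hn0 n Hn).
    destruct (almost_euler_lagrange W w b (f n) (df n) L b0 B (K n) m (/ (INR n + 1)) N)
      as [c Hc]; auto; [unfold N; lra|].
    assert (Hsq : M * / (INR n + 1) <= e ^ 2).
    { replace (e ^ 2) with (M * (e ^ 2 / M)) by (field; lra).
      apply Rmult_le_compat_l; lra. }
    assert (Hc' : forall s, Rabs s <= N -> Rabs (D (f n) s - c * s) <= e).
    { intros s Hs. specialize (Hc s Hs). unfold D.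
      assert ((f n s - f n 0 - int (force w b (f n)) 0 s - c * s) ^ 2 <= e ^ 2)
        by (unfold M in Hsq; lra).
      apply Rabs_le. split; nra. }
    pose proof (HD N e (f n) t ltac:(unfold N; lra) (Hfc n) Hfg ltac:(unfold N; lra)) as D1.
    assert (H1N : Rabs 1 <= N) by (rewrite Rabs_R1; unfold N; lra).
    pose proof (HD N e (f n) 1 ltac:(unfold N; lra) (Hfc n) Hfg H1N) as D2.
    pose proof (Hc' t ltac:(unfold N; lra)) as D3. pose proof (Hc' 1 H1N) as D4.
    replace (D g t - t * D g 1) with
      (- (D (f n) t - D g t) + (D (f n) t - c * t)
       + t * ((D (f n) 1 - D g 1) - (D (f n) 1 - c * 1))) by ring.
    replace eta with (A * e) by (unfold e; field; lra).
    eapply Rle_trans; [apply Rabs_triang|]. rewrite Rabs_mult.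
    assert (D5 : Rabs (- (D (f n) t - D g t) + (D (f n) t - c * t))
      <= (3 + B * L * N * N) * e).
    { apply Rabs_le_between in D1, D3. apply Rabs_le. lra. }
    assert (D6 : Rabs ((D (f n) 1 - D g 1) - (D (f n) 1 - c * 1)) <= (3 + B * L * N * N) * e).
    { apply Rabs_le_between in D2, D4. apply Rabs_le. lra. }
    assert (Rabs t * Rabs ((D (f n) 1 - D g 1) - (D (f n) 1 - c * 1))
      <= Rabs t * ((3 + B * L * N * N) * e)) by (apply Rmult_le_compat_l; lra).
    unfold A. lra. }
  assert (E : D g t - t * D g 1 = 0).
  { apply Rabs_le_between in Hz. lra. }
  unfold D in E |- *. lra.
Qed.

Lemma pot_well (W w : R -> R) (L e : R) : potential W w L -> 0 < e ->
  exists omega, 0 < omega /\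
    forall y, e <= Rabs (y - 1) -> e <= Rabs (y + 1) -> omega <= W y.
Proof.
  intros HW He. pose proof (pot_cont _ _ _ HW) as HWc.
  (* The bumps lift [W] to positive values at the two wells and vanish at distance [e] from them.
     The minimum of [F] over the full interval [[-2, 2]] thus bounds [W] away from the wells; beyond
     it [pot_lower] gives at least 1. *)
  set (F := fun y => W y + (clip 0 e (e - Rabs (y - 1)) + clip 0 e (e - Rabs (y + 1)))).
  assert (HFc : cont F) by (pose proof (cont_clip 0 e); unfold F; ct).
  destruct (cont_min F (-2) 2 ltac:(lra) HFc) as (s & Hs & Hmin).
  assert (HFs : 0 < F s).
  { unfold F. pose proof (clip_bounds 0 e (e - Rabs (s - 1)) ltac:(lra)).
    pose proof (clip_bounds 0 e (e - Rabs (s + 1)) ltac:(lra)).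
    pose proof (pot_nonneg _ _ _ HW s).
    destruct (Req_dec s 1) as [->|Hs1].
    - replace (1 - 1) with 0 in * by ring. rewrite Rabs_R0 in *.
      rewrite (clip_high 0 e (e - 0)) in * by lra. lra.
    - destruct (Req_dec s (-1)) as [->|Hs2].
      + replace (-1 + 1) with 0 in * by ring. rewrite Rabs_R0 in *.
        rewrite (clip_high 0 e (e - 0)) in * by lra. lra.
      + pose proof (pot_pos _ _ _ HW s Hs2 Hs1). lra. }
  exists (Rmin 1 (F s)). split; [apply Rmin_glb_lt; lra|].
  intros y H1 H2.
  destruct (Rle_dec 2 (Rabs y)) as [Hy|Hy].
  - eapply Rle_trans; [apply Rmin_l|]. pose proof (pot_lower _ _ _ HW y). lra.
  - eapply Rle_trans; [apply Rmin_r|].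
    assert (Hy2 : -2 <= y <= 2) by (apply Rabs_le_between; lra).
    specialize (Hmin y Hy2). unfold F in Hmin at 2.
    rewrite (clip_low 0 e (e - Rabs (y - 1))), (clip_low 0 e (e - Rabs (y + 1))) in Hmin by lra.
    lra.
Qed.

(** Each late time at which [g] is away from the wells carries, by uniform continuity, a window of
    fixed length [r] that costs at least [q]. Unboundedly many disjoint windows would exceed [M]. *)
Lemma finite_action_near_wells (W w b g : R -> R) (L b0 B M e : R) :
  potential W w L -> coefficient b b0 B -> uniformly_cont g ->
  (forall u v, u <= v -> int (fun t => b t * W (g t)) u v <= M) -> 0 < e ->
  exists R0, forall t, R0 <= t -> Rabs (g t - 1) <= e \/ Rabs (g t + 1) <= e.
Proof.
  intros HW Hb Hg HM He.
  pose proof (uniformly_cont_cont g Hg) as Hgc.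
  pose proof (pot_cont _ _ _ HW) as HWc. pose proof (coef_cont _ _ _ Hb) as Hbc.
  pose proof (coef_pos _ _ _ Hb) as Hb0. pose proof (coef_bounds _ _ _ Hb) as Hbb.
  destruct (pot_well W w L (e / 2) HW ltac:(lra)) as (omega & Hom & Hwell).
  destruct (Hg (e / 2) ltac:(lra)) as (r & Hr & Hgr).
  apply NNPP. intros Hn.
  assert (Hfar : forall R0, exists t, R0 <= t /\ e < Rabs (g t - 1) /\ e < Rabs (g t + 1)).
  { intros R0. apply NNPP. intros Hn'. apply Hn. exists R0. intros t Ht.
    apply NNPP. intros Hc. apply Hn'. exists t.
    apply not_or_and in Hc. destruct Hc. repeat split; auto; lra. }
  set (F := fun t => b t * W (g t)) in *.
  assert (HFc : cont F) by (unfold F; ct).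
  assert (HF0 : forall t, 0 <= F t).
  { intros t. unfold F. specialize (Hbb t). pose proof (pot_nonneg _ _ _ HW (g t)).
    apply Rmult_le_pos; lra. }
  set (q := b0 * omega * r).
  assert (Hq : 0 < q) by (unfold q; repeat apply Rmult_lt_0_compat; lra).
  assert (Hk : forall k : nat, exists T, 0 <= T /\ INR k * q <= int F 0 T).
  { induction k as [|k (T & HT & IH)].
    - exists 0. rewrite int_point. simpl. lra.
    - destruct (Hfar T) as (t & Ht & H1 & H2). exists (t + r). split; [lra|].
      rewrite S_INR. rewrite <- (int_chasles F 0 T (t + r)) by assumption.
      assert (A : q <= int F T (t + r)).
      { apply Rle_trans with (int F t (t + r)); [|apply int_subinterval; auto; lra].
        replace q with (b0 * omega * (t + r - t)) by (unfold q; ring).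
        apply int_ge_const; [lra|assumption|]. intros s Hs. unfold F.
        assert (Hst : Rabs (g s - g t) <= e / 2).
        { apply Hgr. rewrite Rabs_pos_eq; lra. }
        assert (omega <= W (g s)).
        { apply Hwell; revert Hst H1 H2; unfold Rabs; repeat destruct Rcase_abs; lra. }
        specialize (Hbb s). apply Rmult_le_compat; lra. }
      lra. }
  destruct (archimed_cor1 (q / (Rabs M + 1))) as (k & Hk1 & Hk2).
  { apply Rdiv_lt_0_compat; [lra|]. pose proof (Rabs_pos M). lra. }
  destruct (Hk k) as (T & HT & HkT). specialize (HM 0 T HT).
  pose proof (Rabs_pos M). pose proof (Rle_abs M). apply lt_0_INR in Hk2.
  assert (Rabs M + 1 < INR k * q); [|lra].
  apply (Rmult_lt_compat_l (INR k * (Rabs M + 1))) in Hk1; [|nra].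
  replace (INR k * (Rabs M + 1) * / INR k) with (Rabs M + 1) in Hk1 by (field; lra).
  replace (INR k * (Rabs M + 1) * (q / (Rabs M + 1))) with (INR k * q) in Hk1 by (field; lra).
  exact Hk1.
Qed.

(** Once [g] stays within [/ 2] of the two wells it cannot vanish, so by the intermediate value
    theorem its sign is frozen, and the sign selects the well. *)
Lemma finite_action_limit (W w b g : R -> R) (L b0 B M : R) :
  potential W w L -> coefficient b b0 B -> uniformly_cont g ->
  (forall u v, u <= v -> int (fun t => b t * W (g t)) u v <= M) ->
  (forall e, 0 < e -> exists R0, forall t, R0 <= t -> Rabs (g t - 1) <= e) \/
  (forall e, 0 < e -> exists R0, forall t, R0 <= t -> Rabs (g t + 1) <= e).
Proof.
  intros HW Hb Hg HM.
  pose proof (uniformly_cont_cont g Hg) as Hgc.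
  assert (Hnear := fun e => finite_action_near_wells W w b g L b0 B M e HW Hb Hg HM).
  destruct (Hnear (/ 2) ltac:(lra)) as [R1 HR1].
  assert (Hside : forall t, R1 <= t -> 0 < g R1 * g t).
  { intros t Ht. apply Rnot_le_lt. intros Hneg.
    assert (exists s, R1 <= s <= t /\ g R1 * g s = 0) as (s & Hs & Es).
    { destruct (cont_ivt (fun s => - (g R1 * g s)) R1 t 0) as (s & Hs & Es); auto.
      - ct.
      - pose proof (pow2_ge_0 (g R1)). split; nra.
      - exists s. split; auto. lra. }
    assert (Hnz : forall r, R1 <= r -> g r <> 0).
    { intros r Hr E. destruct (HR1 r Hr) as [H|H]; rewrite E in H;
        revert H; unfold Rabs; destruct Rcase_abs; lra. }
    apply Rmult_integral in Es. destruct Es as [E|E]; apply Hnz in E; lra. }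
  destruct (Rlt_dec 0 (g R1)) as [Hp|Hp].
  - left. intros e He. destruct (Hnear (Rmin e (/ 2))) as [R2 HR2]; [apply Rmin_glb_lt; lra|].
    exists (Rmax R1 R2). intros t Ht.
    pose proof (Rmax_l R1 R2). pose proof (Rmax_r R1 R2).
    pose proof (Rmin_l e (/ 2)). pose proof (Rmin_r e (/ 2)).
    specialize (Hside t ltac:(lra)).
    destruct (HR2 t ltac:(lra)) as [H3|H3]; [lra|].
    exfalso. apply Rabs_le_between in H3. nra.
  - right. intros e He. destruct (Hnear (Rmin e (/ 2))) as [R2 HR2]; [apply Rmin_glb_lt; lra|].
    exists (Rmax R1 R2). intros t Ht.
    pose proof (Rmax_l R1 R2). pose proof (Rmax_r R1 R2).
    pose proof (Rmin_l e (/ 2)). pose proof (Rmin_r e (/ 2)).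
    specialize (Hside t ltac:(lra)).
    destruct (HR2 t ltac:(lra)) as [H3|H3]; [|lra].
    exfalso. apply Rabs_le_between in H3. nra.
Qed.

(** * Existence and range of the heteroclinic *)

(** On a fixed interval one path close to [g] has almost the same potential energy, and its kinetic
    energy is simply dropped. Only finiteness matters later, so an error of 1 is allowed. *)
Lemma cluster_potential_energy (W w b g : R -> R) (f df : nat -> R -> R) (K : nat -> R)
    (L b0 B M C u v : R) :
  potential W w L -> coefficient b b0 B ->
  (forall n, path (f n) (df n) (K n)) ->
  (forall n, action W b (f n) (df n) (- K n) (K n) <= M) ->
  (forall n t, Rabs (f n t) <= C) ->
  cluster f g -> cont g -> u <= v -> int (fun t => b t * W (g t)) u v <= M + 1.
Proof.
  intros HW Hb Hf Ha HC Hcl Hg Huv.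
  pose proof (pot_cont _ _ _ HW) as HWc. pose proof (coef_cont _ _ _ Hb) as Hbc.
  pose proof (coef_pos _ _ _ Hb) as Hb0. pose proof (coef_bounds _ _ _ Hb) as Hbb.
  pose proof (pot_L_nonneg _ _ _ HW) as HL.
  assert (HB : 0 <= B) by (specialize (Hbb 0); lra).
  assert (HC0 : 0 <= C).
  { specialize (HC 0%nat 0). pose proof (Rabs_pos (f 0%nat 0)). lra. }
  (* In [C + 2], the part [C + 1] comes from [w 1 = 0] and the Lipschitz bound on [w], and the last
     1 from the quadratic remainder, where [e ^ 2 <= e]. *)
  set (A := B * (L * (C + 2)) * (v - u)).
  assert (HA : 0 <= A) by (unfold A; repeat (apply Rmult_le_pos; try lra)).
  set (e := / (A + 1)).
  assert (He : 0 < e) by (apply Rinv_0_lt_compat; lra).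
  assert (HAe : (A + 1) * e = 1) by (unfold e; field; lra).
  assert (He1 : e <= 1) by nra.
  destruct (Hcl (Rmax (Rabs u) (Rabs v)) e 0%nat He) as (n & _ & Hfg).
  assert (Hfc : cont (f n)) by (eapply path_cont; eauto).
  assert (Hlc : cont (lagrangian W b (f n) (df n))) by (eapply path_lagrangian_cont; eauto).
  apply Rle_trans with (int (fun t => lagrangian W b (f n) (df n) t + B * (L * (C + 2)) * e) u v).
  - apply int_le; [lra|ct|ct|]. intros t Ht. unfold lagrangian.
    assert (Hd : Rabs (f n t - g t) <= e).
    { apply Hfg. pose proof (Rmax_l (Rabs u) (Rabs v)). pose proof (Rmax_r (Rabs u) (Rabs v)).
      pose proof (Rle_abs (- u)). pose proof (Rle_abs v). rewrite Rabs_Ropp in *.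
      apply Rabs_le. lra. }
    pose proof (pot_quadratic W w L (f n t) (g t) HW) as Hq.
    pose proof (pot_lipschitz _ _ _ HW (f n t) 1) as Hw.
    rewrite (pot_d1 _ _ _ HW), Rminus_0_r in Hw.
    assert (Hw' : Rabs (w (f n t)) <= L * (C + 1)).
    { eapply Rle_trans; [exact Hw|]. apply Rmult_le_compat_l; [lra|].
      specialize (HC n t). apply Rabs_le_between in HC. apply Rabs_le. lra. }
    assert (Hwd : w (f n t) * (g t - f n t) <= L * (C + 1) * e).
    { eapply Rle_trans; [apply Rle_abs|]. rewrite Rabs_mult.
      rewrite Rabs_minus_sym in Hd.
      apply Rmult_le_compat; auto using Rabs_pos. }
    assert (Hd2 : (g t - f n t) ^ 2 <= e).
    { apply Rabs_le_between in Hd. nra. }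
    assert (W (g t) <= W (f n t) + L * (C + 2) * e).
    { apply Rabs_le_between in Hq. nra. }
    specialize (Hbb t). pose proof (pow2_ge_0 (df n t)).
    assert (b t * W (g t) <= b t * (W (f n t) + L * (C + 2) * e))
      by (apply Rmult_le_compat_l; lra).
    assert (b t * (L * (C + 2) * e) <= B * (L * (C + 2) * e)).
    { apply Rmult_le_compat_r; [|lra]. repeat (apply Rmult_le_pos; try lra). }
    lra.
  - rewrite int_plus, int_const by ct.
    pose proof (action_sub W w b (f n) (df n) L b0 B (K n) u v HW Hb (Hf n) Huv) as Hs.
    unfold action at 1 in Hs. specialize (Ha n).
    replace (B * (L * (C + 2)) * e * (v - u)) with (A * e) by (unfold A; ring). lra.
Qed.

Lemma heteroclinic_exists (W w b bP : R -> R) (L b0 B T : R) :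
  potential W w L -> coefficient b b0 B -> coefficient bP b0 B ->
  (forall t, b t < bP t) -> 0 < T -> (forall t, bP (t + T) = bP t) ->
  (forall e, 0 < e -> exists R0, forall t, R0 <= t -> bP t <= b t + e) ->
  (forall e, 0 < e -> exists R0, forall t, t <= R0 -> bP t <= b t + e) ->
  exists g dg, (forall t, is_derive g t (dg t)) /\
    (forall t, is_derive dg t (b t * w (g t))) /\
    (forall e, 0 < e -> exists R0, forall t, R0 <= t -> Rabs (g t - 1) <= e) /\
    (forall e, 0 < e -> exists R0, forall t, t <= R0 -> Rabs (g t + 1) <= e).
Proof.
  intros HW Hb HbP Hlt HT Hper Hright Hleft.
  destruct (min_level_exists W w b L b0 B HW Hb) as (m & Hm0 & Hm).
  destruct (min_level_exists W w bP L b0 B HW HbP) as (mP & _ & HmP).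
  pose proof (min_level_lt W w b bP L b0 B T m mP HW Hb HbP Hlt HT Hper Hm HmP) as Hgap.
  destruct Hm as [Hm1 Hm2]. destruct HmP as [HmP _].
  assert (Hseq : forall n : nat, exists p : (R -> R) * (R -> R) * R,
    path (fst (fst p)) (snd (fst p)) (snd p) /\
    action W b (fst (fst p)) (snd (fst p)) (- snd p) (snd p) <= m + / (INR n + 1)).
  { intros n. destruct (Hm2 (/ (INR n + 1))) as (x & dx & K & Hx & Hxa).
    - apply Rinv_0_lt_compat. pose proof (pos_INR n). lra.
    - exists (x, dx, K). simpl. split; auto. lra. }
  apply choice in Hseq. destruct Hseq as [p Hp].
  set (f := fun n => fst (fst (p n))). set (df := fun n => snd (fst (p n))).
  set (K := fun n => snd (p n)).
  assert (Hf : forall n, path (f n) (df n) (K n)) by (intros n; apply Hp).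
  assert (Ha : forall n, action W b (f n) (df n) (- K n) (K n) <= m + / (INR n + 1))
    by (intros n; apply Hp).
  clearbody f df K. clear p Hp.
  set (M := m + 1).
  assert (HaM : forall n, action W b (f n) (df n) (- K n) (K n) <= M).
  { intros n. eapply Rle_trans; [apply Ha|]. unfold M. apply Rplus_le_compat_l.
    rewrite <- Rinv_1. apply Rinv_le_contravar; [lra|]. pose proof (pos_INR n). lra. }
  set (C := M / b0 + 2 + (2 * M + 1)).
  assert (HC : forall n t, Rabs (f n t) <= C).
  { intros n t. apply (action_bounded W w b (f n) (df n) L b0 B (K n) M t); auto. }
  assert (Heq : forall e, 0 < e -> exists r, 0 < r /\
     forall n s t, Rabs (s - t) <= r -> Rabs (f n s - f n t) <= e).
  { intros e He. assert (HM : 0 < M) by (unfold M; lra).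
    exists (e ^ 2 / (2 * M)). split.
    - apply Rdiv_lt_0_compat; [now apply pow_lt|lra].
    - intros n s t Hst.
      pose proof (action_holder W w b (f n) (df n) L b0 B (K n) M s t HW Hb (Hf n) (HaM n)) as Hh.
      assert ((f n s - f n t) ^ 2 <= e ^ 2).
      { eapply Rle_trans; [exact Hh|].
        replace (e ^ 2) with (2 * M * (e ^ 2 / (2 * M))) by (field; lra).
        apply Rmult_le_compat_l; lra. }
      apply Rabs_le. split; nra. }
  destruct (ascoli f C HC Heq) as [g Hcl]. fold (cluster f g) in Hcl.
  pose proof (cluster_uniformly_cont f g Heq Hcl) as Hguc.
  pose proof (uniformly_cont_cont g Hguc) as Hgc.
  pose proof (pot_cont _ _ _ HW) as HWc. pose proof (pot_dcont _ _ _ HW) as Hwc.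
  pose proof (coef_cont _ _ _ Hb) as Hbc.
  assert (HE : forall u v, u <= v -> int (fun t => b t * W (g t)) u v <= M + 1).
  { intros u v Huv. now apply (cluster_potential_energy W w b g f df K L b0 B M C). }
  destruct (cluster_euler_lagrange W w b g f df K L b0 B m HW Hb Hm1 Hf Ha Hcl Hgc) as [c Hc].
  assert (HFd : forall t, is_derive (force w b g) t (b t * w (g t))).
  { intros t. apply (derive_int (fun s => b s * w (g s))). ct. }
  assert (HFc : cont (force w b g)) by (eapply cont_derive; exact HFd).
  exists g, (fun t => c + force w b g t). split; [|split; [|split]].
  - intros t. apply (is_derive_ext (fun t => g 0 + c * t + int (force w b g) 0 t)).
    { intros s. symmetry. apply Hc. }
    apply is_derive_Reals.
    apply (derivable_pt_lim_plus (fun t => g 0 + c * t) (fun t => int (force w b g) 0 t)).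
    + apply is_derive_Reals. auto_derive; [exact I|ring].
    + apply is_derive_Reals. now apply derive_int.
  - intros t. apply is_derive_Reals. rewrite <- (Rplus_0_l (b t * w (g t))).
    apply (derivable_pt_lim_plus (fun _ => c)); [apply derivable_pt_lim_const|].
    apply is_derive_Reals, HFd.
  - destruct (finite_action_limit W w b g L b0 B (M + 1)) as [H|H]; auto.
    exfalso. revert H.
    apply (cluster_not_m1_right W w b bP g f df K L b0 B m mP); auto.
  (* For the left end time alone is reversed, so the two alternatives keep their wells. *)
  - destruct (finite_action_limit W w (fun t => b (- t)) (fun t => g (- t)) L b0 B (M + 1))
      as [H|H]; auto using coefficient_reflect.
    + intros e He. destruct (Hguc e He) as (r & Hr & Hgr). exists r. split; auto.
      intros s t Hst. apply Hgr. replace (- s - - t) with (- (s - t)) by ring.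
      now rewrite Rabs_Ropp.
    + intros u v Huv. rewrite (int_reflect (fun t => b t * W (g t))) by ct. apply HE. lra.
    + exfalso.
      apply (cluster_not_1_left W w b bP g f df K L b0 B m mP HW Hb HbP Hleft HmP
        ltac:(lra) Hf Ha Hcl).
      intros e He. destruct (H e He) as [R0 HR0]. exists (- R0). intros t Ht.
      rewrite <- (Ropp_involutive t). apply HR0. lra.
    + intros e He. destruct (H e He) as [R0 HR0]. exists (- R0). intros t Ht.
      rewrite <- (Ropp_involutive t). apply HR0. lra.
Qed.

(** * Maximum principle and uniqueness for the Cauchy problem *)

Lemma heteroclinic_le_1 (w b x dx : R -> R) :
  (forall t, 0 < b t) -> (forall y, 1 < y -> 0 < w y) ->
  (forall t, is_derive x t (dx t)) -> (forall t, is_derive dx t (b t * w (x t))) ->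
  (forall e, 0 < e -> exists R0, forall t, R0 <= t -> Rabs (x t - 1) <= e) ->
  (forall e, 0 < e -> exists R0, forall t, t <= R0 -> Rabs (x t + 1) <= e) ->
  forall t, x t <= 1.
Proof.
  intros Hb Hw Hx Hdx Hr Hl t1. apply Rnot_lt_le. intros Ht1.
  pose proof (cont_derive x dx Hx) as Hxc.
  destruct (Hr ((x t1 - 1) / 2)) as [R1 HR1]; [lra|].
  destruct (Hl ((x t1 - 1) / 2)) as [R2 HR2]; [lra|].
  pose proof (Rmin_l t1 R2). pose proof (Rmin_r t1 R2).
  pose proof (Rmax_l t1 R1). pose proof (Rmax_r t1 R1).
  destruct (cont_max x (Rmin t1 R2) (Rmax t1 R1)) as (s & Hs & Hmax); [lra|auto|].
  assert (Hst1 : x t1 <= x s) by (apply Hmax; lra).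
  assert (Hglob : forall t, x t <= x s).
  { intros t. destruct (Rlt_dec t (Rmin t1 R2)).
    - specialize (HR2 t ltac:(lra)). apply Rabs_le_between in HR2. lra.
    - destruct (Rlt_dec (Rmax t1 R1) t).
      + specialize (HR1 t ltac:(lra)). apply Rabs_le_between in HR1. lra.
      + apply Hmax. lra. }
  assert (Hds : dx s = 0).
  { assert (- dx s = 0); [|lra].
    apply (derive_zero_at_min (fun t => - x t) s).
    - apply (is_derive_opp x), Hx.
    - intros t. specialize (Hglob t). lra. }
  destruct (cont_eps x s (x s - 1) Hxc) as (d & Hd & Hxd); [lra|].
  (* Two mean value steps replace a second derivative test: [x > 1] near [s] makes [dx] increase
     from 0, so [x] rises above its supposed maximum. *)
  destruct (MVT_cor2 x dx s (s + d / 2)) as (c & Ec & Hc); [lra| |].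
  { intros; apply is_derive_Reals, Hx. }
  destruct (MVT_cor2 dx (fun t => b t * w (x t)) s c) as (c' & Ec' & Hc'); [lra| |].
  { intros; apply is_derive_Reals, Hdx. }
  assert (1 < x c').
  { specialize (Hxd c'). rewrite Rabs_pos_eq in Hxd by lra.
    specialize (Hxd ltac:(lra)). apply Rabs_def2 in Hxd. lra. }
  assert (0 < b c' * w (x c')) by (apply Rmult_lt_0_compat; auto).
  assert (0 < dx c) by (rewrite Hds in Ec'; nra).
  specialize (Hglob (s + d / 2)). nra.
Qed.

(** Gronwall for the energy [q = u ^ 2 + du ^ 2], which satisfies [Rabs (dq s) <= (1 + C) * q s]:
    multiplied by a decaying exponential after [t0], or a growing one before, it is monotone and
    vanishes at [t0]. *)
Lemma linear_bound_unique (u du ddu : R -> R) (C t0 : R) : 0 <= C ->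
  (forall t, is_derive u t (du t)) -> (forall t, is_derive du t (ddu t)) ->
  (forall t, Rabs (ddu t) <= C * Rabs (u t)) -> u t0 = 0 -> du t0 = 0 ->
  forall t, u t = 0.
Proof.
  intros HC Hu Hdu Hb H0 H1 t.
  set (q := fun t => u t * u t + du t * du t).
  set (dq := fun t => (du t * u t + u t * du t) + (ddu t * du t + du t * ddu t)).
  assert (Hq : forall s, is_derive q s (dq s)).
  { intros s. specialize (Hu s). specialize (Hdu s).
    apply is_derive_Reals. apply is_derive_Reals in Hu, Hdu.
    apply (derivable_pt_lim_plus (fun s => u s * u s) (fun s => du s * du s)).
    - now apply (derivable_pt_lim_mult u u).
    - now apply (derivable_pt_lim_mult du du). }
  assert (Hq0 : q t0 = 0) by (unfold q; rewrite H0, H1; ring).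
  assert (Hqn : forall s, 0 <= q s) by (intros s; unfold q; nra).
  assert (Hdq : forall s, Rabs (dq s) <= (1 + C) * q s).
  { intros s. unfold dq, q. specialize (Hb s).
    assert (A : Rabs (2 * u s * du s) <= u s * u s + du s * du s).
    { pose proof (pow2_ge_0 (u s + du s)). pose proof (pow2_ge_0 (u s - du s)).
      apply Rabs_le. lra. }
    assert (A' : Rabs (2 * ddu s * du s) <= C * (u s * u s + du s * du s)).
    { rewrite !Rabs_mult, (Rabs_pos_eq 2) by lra.
      rewrite !Rabs_mult, (Rabs_pos_eq 2) in A by lra.
      assert (Rabs (ddu s) * Rabs (du s) <= C * Rabs (u s) * Rabs (du s))
        by (apply Rmult_le_compat_r; auto using Rabs_pos).
      nra. }
    replace (du s * u s + u s * du s + (ddu s * du s + du s * ddu s))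
      with (2 * u s * du s + 2 * ddu s * du s) by ring.
    eapply Rle_trans; [apply Rabs_triang|]. lra. }
  assert (Hexp : forall k s, is_derive (fun r => q r * exp (k * (r - t0))) s
    ((dq s + k * q s) * exp (k * (s - t0)))).
  { intros k s. specialize (Hq s). apply is_derive_Reals. apply is_derive_Reals in Hq.
    replace ((dq s + k * q s) * exp (k * (s - t0)))
      with (dq s * exp (k * (s - t0)) + q s * (k * exp (k * (s - t0)))) by ring.
    apply (derivable_pt_lim_mult q (fun r => exp (k * (r - t0)))); auto.
    apply is_derive_Reals. auto_derive; [exact I|unfold Rminus; ring]. }
  assert (Hqt : q t <= 0).
  { destruct (Rle_dec t0 t) as [Ht|Ht].
    - assert (Hm := derive_mono (fun r => - (q r * exp (- (1 + C) * (r - t0))))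
        (fun s => - ((dq s + - (1 + C) * q s) * exp (- (1 + C) * (s - t0)))) t0 t Ht).
      cbv beta in Hm. rewrite Hq0 in Hm.
      assert (Hm' : - (0 * exp (- (1 + C) * (t0 - t0))) <= - (q t * exp (- (1 + C) * (t - t0)))).
      { apply Hm.
        - intros s. apply (is_derive_opp (fun r => q r * exp (- (1 + C) * (r - t0)))), Hexp.
        - intros s _. specialize (Hdq s). apply Rabs_le_between in Hdq.
          pose proof (exp_pos (- (1 + C) * (s - t0))). nra. }
      pose proof (exp_pos (- (1 + C) * (t - t0))). nra.
    - assert (Hm := derive_mono (fun r => q r * exp ((1 + C) * (r - t0)))
        (fun s => (dq s + (1 + C) * q s) * exp ((1 + C) * (s - t0))) t t0 ltac:(lra) (Hexp _)).
      cbv beta in Hm. rewrite Hq0 in Hm.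
      assert (Hm' : q t * exp ((1 + C) * (t - t0)) <= 0 * exp ((1 + C) * (t0 - t0))).
      { apply Hm. intros s _. specialize (Hdq s). apply Rabs_le_between in Hdq.
        pose proof (exp_pos ((1 + C) * (s - t0))). nra. }
      pose proof (exp_pos ((1 + C) * (t - t0))). nra. }
  unfold q in Hqt. nra.
Qed.

(** A contact with 1 is a maximum, so [x] there has the Cauchy data of the constant solution 1;
    coinciding with it contradicts the limit -1 at the left end. *)
Lemma heteroclinic_lt_1 (W w b x dx : R -> R) (L b0 B : R) :
  potential W w L -> coefficient b b0 B -> (forall y, 1 < y -> 0 < w y) ->
  (forall t, is_derive x t (dx t)) -> (forall t, is_derive dx t (b t * w (x t))) ->
  (forall e, 0 < e -> exists R0, forall t, R0 <= t -> Rabs (x t - 1) <= e) ->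
  (forall e, 0 < e -> exists R0, forall t, t <= R0 -> Rabs (x t + 1) <= e) ->
  forall t, x t < 1.
Proof.
  intros HW Hb Hw Hx Hdx Hr Hl t0.
  pose proof (coef_pos _ _ _ Hb) as Hb0. pose proof (coef_bounds _ _ _ Hb) as Hbb.
  pose proof (pot_L_nonneg _ _ _ HW) as HL.
  assert (Hle : forall t, x t <= 1).
  { apply (heteroclinic_le_1 w b x dx); auto. intros t. specialize (Hbb t). lra. }
  destruct (Hle t0) as [|E]; [assumption|exfalso].
  assert (Hu : forall t, x t - 1 = 0).
  { apply (linear_bound_unique (fun t => x t - 1) dx (fun t => b t * w (x t)) (B * L) t0).
    - apply Rmult_le_pos; [specialize (Hbb 0)|]; lra.
    - intros t. specialize (Hx t). apply is_derive_Reals. apply is_derive_Reals in Hx.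
      rewrite <- (Rminus_0_r (dx t)). apply (derivable_pt_lim_minus x (fun _ => 1)); auto.
      apply derivable_pt_lim_const.
    - exact Hdx.
    - intros t. rewrite Rabs_mult. specialize (Hbb t). rewrite (Rabs_pos_eq (b t)) by lra.
      rewrite Rmult_assoc. apply Rmult_le_compat; [lra|apply Rabs_pos|lra|].
      rewrite <- (Rminus_0_r (w (x t))), <- (pot_d1 _ _ _ HW). apply HW.
    - lra.
    - assert (- dx t0 = 0); [|lra]. apply (derive_zero_at_min (fun t => - x t) t0).
      + apply (is_derive_opp x), Hx.
      + intros t. specialize (Hle t). lra. }
  destruct (Hl 1 ltac:(lra)) as [R0 HR0]. specialize (HR0 R0 ltac:(lra)).
  specialize (Hu R0). apply Rabs_le_between in HR0. lra.
Qed.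

Lemma heteroclinic_gt_m1 (W w b x dx : R -> R) (L b0 B : R) :
  potential W w L -> coefficient b b0 B -> (forall y, y < -1 -> w y < 0) ->
  (forall t, is_derive x t (dx t)) -> (forall t, is_derive dx t (b t * w (x t))) ->
  (forall e, 0 < e -> exists R0, forall t, R0 <= t -> Rabs (x t - 1) <= e) ->
  (forall e, 0 < e -> exists R0, forall t, t <= R0 -> Rabs (x t + 1) <= e) ->
  forall t, -1 < x t.
Proof.
  intros HW Hb Hw Hx Hdx Hr Hl t.
  assert (H : forall s, - x (- s) < 1).
  { apply (heteroclinic_lt_1 (fun y => W (- y)) (fun y => - w (- y)) (fun s => b (- s))
      (fun s => - x (- s)) (fun s => dx (- s)) L b0 B);
      auto using potential_reflect, coefficient_reflect.
    - intros y Hy. specialize (Hw (- y) ltac:(lra)). lra.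
    - intros s. apply derive_reflect, Hx.
    - intros s. rewrite Ropp_involutive.
      replace (b (- s) * - w (x (- s))) with (-1 * (b (- s) * w (x (- s)))) by ring.
      apply (is_derive_comp dx (fun s => - s)); [apply Hdx|]. auto_derive; auto.
    - intros e He. destruct (Hl e He) as [R0 HR0]. exists (- R0). intros s Hs.
      replace (- x (- s) - 1) with (- (x (- s) + 1)) by ring. rewrite Rabs_Ropp.
      apply HR0. lra.
    - intros e He. destruct (Hr e He) as [R0 HR0]. exists (- R0). intros s Hs.
      replace (- x (- s) + 1) with (- (x (- s) - 1)) by ring. rewrite Rabs_Ropp.
      apply HR0. lra. }
  specialize (H (- t)). rewrite Ropp_involutive in H. lra.
Qed.

(* The integrated form of [V (clip x) + (x - clip x)^2]: equal to [V] on [-1, 1],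
   quadratic outside, with globally Lipschitz derivative. *)
Definition ext_force (dV : R -> R) (y : R) : R :=
  dV (clip (-1) 1 y) + 2 * (y - clip (-1) 1 y).

Definition ext_potential (dV : R -> R) (y : R) : R := int (ext_force dV) (-1) y.

Lemma ext_is_potential (V dV ddV : R -> R) :
  C2_with V dV ddV -> (forall x, 0 <= V x) -> V (-1) = 0 -> V 1 = 0 ->
  (forall x, -1 < x < 1 -> 0 < V x) ->
  exists L, potential (ext_potential dV) (ext_force dV) L.
Proof.
  intros (HV & HdV & HddV) Hnn Hm1 H1 Hpos.
  assert (HdVc : cont dV) by (now apply cont_derive with ddV).
  pose proof (cont_clip (-1) 1) as Hcl.
  assert (Hfc : cont (ext_force dV)) by (unfold ext_force; ct).
  destruct (cont_max (fun y => Rabs (ddV y)) (-1) 1) as (s & _ & Hs); [lra|exact (cont_abs ddV HddV)|].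
  set (C := Rabs (ddV s)) in *. cbv beta in Hs.
  assert (Hlip : forall x y, -1 <= x <= 1 -> -1 <= y <= 1 ->
    Rabs (dV x - dV y) <= C * Rabs (x - y)).
  { intros x y Hx Hy. destruct (MVT_gen dV y x ddV) as (c & Hc & E).
    - intros; apply HdV.
    - intros; now apply cont_pt.
    - rewrite E, Rabs_mult. apply Rmult_le_compat_r; [apply Rabs_pos|].
      apply Hs. revert Hc. unfold Rmin, Rmax. destruct Rle_dec; lra. }
  assert (Hin : forall y, -1 <= y <= 1 -> ext_potential dV y = V y).
  { intros y Hy. unfold ext_potential. rewrite (int_ext _ dV); [|lra|].
    - rewrite (int_derive V dV) by assumption. lra.
    - intros t Ht. unfold ext_force. rewrite clip_in by lra. ring. }
  (* The wells are minima of [V], so both pieces of the extended force vanish at the junctions, and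
     outside [[-1, 1]] the extension is exactly the squared distance. *)
  assert (HdV1 : dV 1 = 0).
  { apply (derive_zero_at_min V 1); auto. intros; rewrite H1; apply Hnn. }
  assert (HdVm1 : dV (-1) = 0).
  { apply (derive_zero_at_min V (-1)); auto. intros; rewrite Hm1; apply Hnn. }
  assert (Hout1 : forall y, 1 <= y -> ext_potential dV y = (y - 1) ^ 2).
  { intros y Hy. unfold ext_potential. rewrite <- (int_chasles _ (-1) 1 y) by assumption.
    fold (ext_potential dV 1). rewrite Hin, H1 by lra.
    rewrite (int_ext _ (fun t => 2 * (t - 1))); [|lra|].
    - rewrite (int_derive (fun t => (t - 1) ^ 2) (fun t => 2 * (t - 1))); [ring| |ct].
      intros t. auto_derive; [exact I|ring].
    - intros t Ht. unfold ext_force. rewrite clip_high by lra. lra. }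
  assert (Houtm1 : forall y, y <= -1 -> ext_potential dV y = (y + 1) ^ 2).
  { intros y Hy. unfold ext_potential.
    pose proof (int_chasles _ (-1) y (-1) Hfc) as E. rewrite int_point in E.
    rewrite (int_ext _ (fun t => 2 * (t + 1)) y (-1)) in E; [|lra|].
    - rewrite (int_derive (fun t => (t + 1) ^ 2) (fun t => 2 * (t + 1))) in E; [lra| |ct].
      intros t. auto_derive; [exact I|ring].
    - intros t Ht. unfold ext_force. rewrite clip_low by lra. lra. }
  (* [C] bounds [ddV] on [[-1, 1]]; the term [2 * (y - clip (-1) 1 y)] adds at most
     [2 * (1 + 1)]. *)
  exists (C + 4). split.
  - intros x. now apply derive_int.
  - intros x y. unfold ext_force.
    pose proof (clip_lipschitz (-1) 1 x y) as A1.
    pose proof (Hlip (clip (-1) 1 x) (clip (-1) 1 y) (clip_bounds (-1) 1 x ltac:(lra))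
      (clip_bounds (-1) 1 y ltac:(lra))) as A2.
    assert (HC : 0 <= C) by apply Rabs_pos.
    assert (A3 : C * Rabs (clip (-1) 1 x - clip (-1) 1 y) <= C * Rabs (x - y))
      by (apply Rmult_le_compat_l; lra).
    assert (A4 := Rle_trans _ _ _ A2 A3).
    apply Rabs_le_between in A4. apply Rabs_le_between in A1.
    pose proof (Rle_abs (x - y)). pose proof (Rle_abs (- (x - y))). rewrite Rabs_Ropp in *.
    apply Rabs_le. lra.
  - intros x. destruct (Rle_dec x (-1)); [rewrite Houtm1 by lra; apply pow2_ge_0|].
    destruct (Rle_dec 1 x); [rewrite Hout1 by lra; apply pow2_ge_0|].
    rewrite Hin by lra. apply Hnn.
  - rewrite Hin; lra.
  - rewrite Hin; lra.
  - intros x Hx1 Hx2. destruct (Rle_dec x (-1)).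
    { rewrite Houtm1 by lra. apply pow2_gt_0. lra. }
    destruct (Rle_dec 1 x).
    { rewrite Hout1 by lra. apply pow2_gt_0. lra. }
    rewrite Hin by lra. apply Hpos. lra.
  - intros x. destruct (Rle_dec x (-1)).
    { rewrite Houtm1, Rabs_left1 by lra. pose proof (pow2_ge_0 (x + 2)). nra. }
    destruct (Rle_dec 1 x).
    { rewrite Hout1, Rabs_pos_eq by lra. pose proof (pow2_ge_0 (x - 2)). nra. }
    rewrite Hin by lra. specialize (Hnn x).
    assert (Rabs x <= 1) by (apply Rabs_le; lra). lra.
Qed.

(** * The rescaled coefficients and the conclusion *)

Lemma periodic_bounded (p : R -> R) : cont p -> periodic p ->
  exists B, forall t, p t <= B.
Proof.
  intros Hp (T & HT & Hper).
  destruct (cont_max p 0 T) as (s & _ & Hs); [lra|assumption|].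
  exists (p s). intros t. destruct (periodic_shift p T t HT Hper) as (k & Hk & E).
  replace (p t) with (p (t - k)).
  - apply Hs. lra.
  - rewrite <- E. f_equal. ring.
Qed.

Lemma lim_abs_diff_p_infty (a aP : R -> R) (k e : R) : 0 < k -> 0 < e ->
  is_lim (fun t => Rabs (a t - aP t)) p_infty 0 ->
  exists R0, forall t, R0 <= t -> aP (k * t) <= a (k * t) + e.
Proof.
  intros Hk He H. apply is_lim_spec in H. destruct (H (mkposreal e He)) as [M HM]. simpl in HM.
  exists ((M + 1) / k). intros t Ht.
  assert (M + 1 <= k * t).
  { replace (M + 1) with (k * ((M + 1) / k)) by (field; lra).
    apply Rmult_le_compat_l; lra. }
  specialize (HM (k * t) ltac:(lra)). rewrite Rminus_0_r, Rabs_Rabsolu in HM.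
  apply Rabs_def2 in HM. lra.
Qed.

Lemma lim_abs_diff_m_infty (a aP : R -> R) (k e : R) : 0 < k -> 0 < e ->
  is_lim (fun t => Rabs (a t - aP t)) m_infty 0 ->
  exists R0, forall t, t <= R0 -> aP (k * t) <= a (k * t) + e.
Proof.
  intros Hk He H. apply is_lim_spec in H. destruct (H (mkposreal e He)) as [M HM]. simpl in HM.
  exists ((M - 1) / k). intros t Ht.
  assert (k * t <= M - 1).
  { replace (M - 1) with (k * ((M - 1) / k)) by (field; lra).
    apply Rmult_le_compat_l; lra. }
  specialize (HM (k * t) ltac:(lra)). rewrite Rminus_0_r, Rabs_Rabsolu in HM.
  apply Rabs_def2 in HM. lra.
Qed.

Theorem theorem4p1
  (V dV ddV : R -> R) (a aP : R -> R)
  (HV : C2_with V dV ddV)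
  (HVnn : forall x, 0 <= V x)
  (HVm1 : V (-1) = 0) (HV1 : V 1 = 0)
  (HVpos : forall x, -1 < x < 1 -> 0 < V x)
  (HddVm1 : 0 < ddV (-1)) (HddV1 : 0 < ddV 1)
  (Ha_cont : forall t, continuous a t)
  (HaP_cont : forall t, continuous aP t)
  (HaP_per : periodic aP)
  (Hlim_p : is_lim (fun t => Rabs (a t - aP t)) p_infty 0)
  (Hlim_m : is_lim (fun t => Rabs (a t - aP t)) m_infty 0)
  (Hinf : 0 < Glb_Rbar (fun y => exists s, y = a s))
  (Hle : forall t, Glb_Rbar (fun y => exists s, y = a s) <= a t)
  (Hlt : forall t, a t < aP t) :
  forall eps : R, 0 < eps ->
  exists x dx ddx : R -> R,
    C2_with x dx ddx /\
    (forall t, ddx t = a (eps * t) * dV (x t)) /\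
    is_lim x m_infty (-1) /\
    is_lim x p_infty 1 /\
    (forall t, -1 < x t < 1).
Proof.
  intros eps Heps.
  destruct (ext_is_potential V dV ddV HV HVnn HVm1 HV1 HVpos) as [L HW].
  set (W := ext_potential dV) in *. set (w := ext_force dV) in *.
  (* [real] sends infinite values to 0, so [Hinf] also says that the infimum is finite. As [a < aP],
     the same [b0] and [B] serve both coefficients. *)
  set (b0 := real (Glb_Rbar (fun y => exists s, y = a s))) in *.
  destruct (periodic_bounded aP HaP_cont HaP_per) as [B HB].
  fold (cont a) in Ha_cont. fold (cont aP) in HaP_cont.
  assert (Hb : coefficient (fun t => a (eps * t)) b0 B).
  { split; auto.
    - ct.
    - intros t. specialize (Hle (eps * t)). specialize (Hlt (eps * t)).
      specialize (HB (eps * t)). lra. }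
  assert (HbP : coefficient (fun t => aP (eps * t)) b0 B).
  { split; auto.
    - ct.
    - intros t. specialize (Hle (eps * t)). specialize (Hlt (eps * t)).
      specialize (HB (eps * t)). lra. }
  destruct HaP_per as (T & HT & Hper).
  destruct (heteroclinic_exists W w (fun t => a (eps * t)) (fun t => aP (eps * t))
    L b0 B (T / eps) HW Hb HbP) as (x & dx & Hx & Hdx & Hr & Hl); auto.
  - apply Rdiv_lt_0_compat; lra.
  - intros t. rewrite <- (Hper (eps * t)). f_equal. field. lra.
  - intros e He. now apply lim_abs_diff_p_infty.
  - intros e He. now apply lim_abs_diff_m_infty.
  - assert (Hlt1 : forall t, x t < 1).
    { apply (heteroclinic_lt_1 W w (fun t => a (eps * t)) x dx L b0 B); auto.
      intros y Hy. unfold w, ext_force. rewrite clip_high by lra.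
      destruct HV as [HV _].
      rewrite (derive_zero_at_min V 1 (dV 1)); [lra|apply HV|].
      intros; rewrite HV1; apply HVnn. }
    assert (Hgt1 : forall t, -1 < x t).
    { apply (heteroclinic_gt_m1 W w (fun t => a (eps * t)) x dx L b0 B); auto.
      intros y Hy. unfold w, ext_force. rewrite clip_low by lra.
      destruct HV as [HV _].
      rewrite (derive_zero_at_min V (-1) (dV (-1))); [lra|apply HV|].
      intros; rewrite HVm1; apply HVnn. }
    pose proof (cont_derive x dx Hx) as Hxc.
    pose proof (pot_dcont _ _ _ HW) as Hwc.
    exists x, dx, (fun t => a (eps * t) * w (x t)).
    split; [|split; [|split; [|split]]].
    + split; [exact Hx|split; [exact Hdx|]].
      change (cont (fun t => a (eps * t) * w (x t))). ct.
    (* Between the wells the truncation is the identity, so the extended force is [dV]. *)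
    + intros t. unfold w, ext_force. specialize (Hlt1 t). specialize (Hgt1 t).
      rewrite clip_in by lra. f_equal. ring.
    + apply is_lim_spec. intros [e He]. destruct (Hl (e / 2) ltac:(lra)) as [R0 HR0].
      exists R0. intros t Ht. specialize (HR0 t ltac:(lra)).
      simpl. replace (x t - -1) with (x t + 1) by ring. lra.
    + apply is_lim_spec. intros [e He]. destruct (Hr (e / 2) ltac:(lra)) as [R0 HR0].
      exists R0. intros t Ht. specialize (HR0 t ltac:(lra)). simpl. lra.
    + intros t. split; auto.
Qed.
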